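(* Let $D$ be a rank $k$ partial flag positroid pipe dream whose pivot columns satisfy $u_i<u_{i+1}$ for some $1\le i\le k-1$, and let $D'=\mathrm{st}_i(D)$. Then $\mathcal B(D)=\mathcal B(D')$.
   Context: Pipe dreams: for $u\in\mathfrak S_n$ use an $n\times n$ array, box $(i,j)$ in row $i$ from the top, column $j$ from the left, tiled by: empty; horizontal pipe; vertical pipe; pivot elbow (one arc from top-edge midpoint to right-edge midpoint); cross; elbow (two arcs: top to right, and left to bottom). A Rothe pipe dream of $u$: (i) $n$ pipes each from the top edge to the right edge; (ii) $(i,u_i)$ is a pivot elbow; (iii) boxes $(i,j)$ with $u^{-1}(j)<i$, $j<u_i$ empty; (iv) boxes with $u^{-1}(j)<i$, $j>u_i$ horizontal pipes; (v) boxes with $u^{-1}(j)>i$, $j<u_i$ vertical pipes; remaining boxes crosses or elbows. Reduced: no two pipes cross twice. Exit permutation $v$: $v_i$ = label (starting column) of the pipe leaving the right edge in row $i$. Pipes touch if they share an elbow tile. A flag positroid pipe dream $\mathrm{FPP}(u,v)$ is a reduced Rothe pipe dream of $u$ with exit permutation $v$ in which two pipes that cross never touch southeast of their crossing. A rank $k$ partial flag positroid pipe dream is the restriction of some $n\times n$ flag positroid pipe dream to its first $k$ rows; its pivot columns are $u_1,\dots,u_k$. Directed graph $G(D)$: a source $s_{u_i}$ at each pivot elbow $(i,u_i)$, a vertex at each (non-pivot) elbow tile, and a sink $t_j$ above each column $j$; each non-sink vertex has an edge to the nearest vertex above it in its column (or to $t_j$ if none); each non-source vertex has an edge into it from the nearest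 vertex to its left in its row. An admissible $k$-collection is a set of $k$ pairwise vertex-disjoint directed paths each from a source to a sink; $\mathcal B(D)$ is the set of $J\subseteq[n]$, $|J|=k$, that are the sink sets $\{j: t_j\text{ is an endpoint}\}$ of admissible $k$-collections. Standardization $\mathrm{st}_i$ ($u_i<u_{i+1}$): with $D_{i,j}$ the tile in box $(i,j)$, let $j^*$ be the smallest $j\ge u_{i+1}$ with $D_{i,j}$ a cross and $D_{i+1,j}$ an elbow or pivot elbow ($j^*=\infty$ if none); $\mathrm{st}_i(D)$ is obtained by exchanging the tiles of rows $i$ and $i+1$ in all columns $j$ with $j\le u_{i+1}$ or $j\ge j^*$, then replacing box $(i,u_i)$ by a vertical pipe, box $(i+1,u_{i+1})$ by a horizontal pipe, and, if $u_{i+1}<j^*\le n$, box $(i+1,j^* )$ by an elbow; all other tiles unchanged. *)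

(* Defs.v *)
From HB Require Import structures.
From mathcomp Require Import all_boot all_fingroup all_algebra.
From mathcomp Require Import classical_sets.

Set Implicit Arguments.
Unset Strict Implicit.
Unset Printing Implicit Defensive.

(* Rows and columns are numbered from 0 throughout.                           *)

Inductive tile := Empty | Horizontal | Vertical | Pivot | Cross | Elbow.

Scheme Boolean Equality for tile.

Lemma tile_eqP : Equality.axiom tile_beq.
Proof. by do 2!case; constructor. Qed.

HB.instance Definition _ := hasDecEq.Build tile tile_eqP.

Inductive in_side := Top | Left.
Inductive out_side := Right | Bottom.

(* Pipes are followed from the top edge of the array to its right edge, so a  *)
(* tile is entered at its top or left and left at its right or bottom.        *)
(* [None]: the tile has no pipe at that entering side.                        *)
Definition route (t : tile) (s : in_side) : option out_side :=
  match t, s with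
  | Horizontal, Left => Some Right
  | Vertical, Top => Some Bottom
  | Pivot, Top => Some Right
  | Cross, Top => Some Bottom
  | Cross, Left => Some Right
  | Elbow, Top => Some Right
  | Elbow, Left => Some Bottom
  | _, _ => None
  end.

(* [enters D p i j s]: the pipe starting at the top of column [p] enters the  *)
(* box (i, j) through its side [s].                                           *)
Inductive enters n (D : 'M[tile]_n) (p : 'I_n) :
    'I_n -> 'I_n -> in_side -> Prop :=
| enters_start (i : 'I_n) : i = 0 :> nat -> enters D p i p Top
| enters_down (i i' j : 'I_n) s : enters D p i j s ->
    route (D i j) s = Some Bottom -> i' = i.+1 :> nat -> enters D p i' j Top
| enters_right (i j j' : 'I_n) s : enters D p i j s ->
    route (D i j) s = Some Right -> j' = j.+1 :> nat -> enters D p i j' Left.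

(* The pipe [p] leaves the array through the right edge in row [i]. *)
Definition exits n (D : 'M[tile]_n) (p i : 'I_n) : Prop :=
  exists (j : 'I_n) (s : in_side),
    [/\ enters D p i j s, route (D i j) s = Some Right & j.+1 = n].

Record rothe_pipe_dream n (u : 'S_n) (D : 'M[tile]_n) : Prop := {
  rothe_pipes : forall p, exists i, exits D p i;
  rothe_pivot : forall i, D i (u i) = Pivot;
  rothe_empty : forall i j : 'I_n,
    (u^-1)%g j < i -> j < u i -> D i j = Empty;
  rothe_horizontal : forall i j : 'I_n,
    (u^-1)%g j < i -> u i < j -> D i j = Horizontal;
  rothe_vertical : forall i j : 'I_n,
    i < (u^-1)%g j -> j < u i -> D i j = Vertical;
  rothe_other : forall i j : 'I_n,
    i < (u^-1)%g j -> u i < j -> D i j = Cross \/ D i j = Elbow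
}.

Definition share_tile n (t : tile) (D : 'M[tile]_n) (p q i j : 'I_n) : Prop :=
  D i j = t /\
  (enters D p i j Top /\ enters D q i j Left \/
   enters D q i j Top /\ enters D p i j Left).

Notation cross_at := (share_tile Cross).
Notation touch_at := (share_tile Elbow).

Definition reduced n (D : 'M[tile]_n) : Prop :=
  forall p q i j i' j' : 'I_n,
    cross_at D p q i j -> cross_at D p q i' j' -> (i, j) = (i', j').

Definition exit_permutation n (v : 'S_n) (D : 'M[tile]_n) : Prop :=
  forall i, exits D (v i) i.

Record flag_positroid_pipe_dream n (u v : 'S_n) (D : 'M[tile]_n) : Prop := {
  fpp_rothe : rothe_pipe_dream u D;
  fpp_reduced : reduced D;
  fpp_exit : exit_permutation v D;
  fpp_no_touch : forall p q i j i' j' : 'I_n,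
    cross_at D p q i j -> touch_at D p q i' j' -> ~ (i < i' /\ j < j')
}.

(* [c] lists the pivot columns of the [k] rows. *)
Definition partial_fpp n k (c : 'I_k -> 'I_n) (D : 'M[tile]_(k, n)) : Prop :=
  exists (le_kn : k <= n) (u v : 'S_n) (F : 'M[tile]_n),
    [/\ flag_positroid_pipe_dream u v F,
        D = rowsub (widen_ord le_kn) F
      & forall i, c i = u (widen_ord le_kn i)].

Section Graph.

Variables (k n : nat) (D : 'M[tile]_(k, n)).

(* [inl (i, j)] stands for the box (i, j), a vertex of the graph only when    *)
(* [is_vertex i j]; [inr j] is the sink t_j.                                  *)
Definition node : Type := ('I_k * 'I_n) + 'I_n.

Definition is_vertex (i : 'I_k) (j : 'I_n) : bool :=
  (D i j == Pivot) || (D i j == Elbow).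

Definition is_source (x : node) : bool :=
  if x is inl (i, j) then D i j == Pivot else false.

Definition column_edge (x y : node) : bool :=
  match x, y with
  | inl (i, j), inl (i', j') =>
      [&& is_vertex i j, is_vertex i' j', j' == j, i' < i &
          [forall r : 'I_k, (i' < r < i) ==> ~~ is_vertex r j]]
  | inl (i, j), inr j' =>
      [&& is_vertex i j, j' == j &
          [forall r : 'I_k, (r < i) ==> ~~ is_vertex r j]]
  | _, _ => false
  end.

Definition row_edge (x y : node) : bool :=
  match x, y with
  | inl (i, j), inl (i', j') =>
      [&& is_vertex i j, is_vertex i' j', ~~ is_source y, i' == i, j < j' &
          [forall l : 'I_n, (j < l < j') ==> ~~ is_vertex i l]]
  | _, _ => false
  end.

Definition edge (x y : node) : bool := column_edge x y || row_edge x y.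

(* A nonempty path is given by its first node and the list of the others. *)
Definition source_sink_path (P : node * seq node) : Prop :=
  [/\ is_source P.1, path edge P.1 P.2
    & exists j : 'I_n, last P.1 P.2 = inr j].

(* The k paths are indexed by 'I_k; vertex-disjointness makes them distinct,  *)
(* so that these families represent exactly the sets of k disjoint paths.     *)
Definition admissible_collection (P : 'I_k -> node * seq node) : Prop :=
  (forall a, source_sink_path (P a)) /\
  (forall a b, a != b ->
     ~ exists x, x \in (P a).1 :: (P a).2 /\ x \in (P b).1 :: (P b).2).

Definition sink_set (P : 'I_k -> node * seq node) : {set 'I_n} :=
  [set j | [exists a, last (P a).1 (P a).2 == inr j]].

Definition bases : set {set 'I_n} :=
  fun J => #|J| = k /\ exists P, admissible_collection P /\ J = sink_set P.

End Graph.

Section Standardization.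

Variables (k n : nat) (c : 'I_k -> 'I_n) (i i' : 'I_k) (D : 'M[tile]_(k, n)).

(* As [enum 'I_n] is increasing, this is the smallest suitable column; its    *)
(* value is [n], playing the role of infinity, when there is none.            *)
Definition jstar : nat :=
  find (fun j : 'I_n =>
          [&& c i' <= j, D i j == Cross &
              (D i' j == Elbow) || (D i' j == Pivot)])
       (enum 'I_n).

(* Meant for consecutive rows i, i' = i + 1 with pivot columns c i < c i'.    *)
Definition standardize : 'M[tile]_(k, n) :=
  \matrix_(r, j)
    if (r == i) && (j == c i) then Vertical
    else if (r == i') && (j == c i') then Horizontal
    else if [&& r == i', c i' < jstar & j == jstar :> nat] then Elbow
    else if (j <= c i') || (jstar <= j) then xrow i i' D r j
    else D r j.

End Standardization.

(* Main.v *)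
Require Import Defs.
From mathcomp Require Import all_boot all_fingroup all_algebra.
From mathcomp Require classical_sets.
From mathcomp Require Import zify.

Set Implicit Arguments.
Unset Strict Implicit.
Unset Printing Implicit Defensive.

(* An admissible k-collection is the same thing as a 0/1 occupation of the
   horizontal and vertical box edges that obeys a local rule at each tile, so
   the bases are the possible top rows of such occupations.  As D and st_i(D)
   differ only in rows i and i+1, it suffices to show that, with the edges
   below and above these two rows prescribed, both can be filled in for D if
   and only if they can for st_i(D).  Reading the two rows from left to right
   gives a pair of finite automata whose states are the occupations of the two
   horizontal edges; one simulates D by st_i(D) forwards, and st_i(D) by D
   backwards.  The only obstruction is an elbow above a cross with a path
   coming from below: there one needs that disjoint paths never cross at a
   cross tile.  To see this, label pipes by their starting columns.  Where two
   pipes meet, the one coming from the left has the smaller label, since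
   otherwise they crossed before.  Hence a pipe z that has crossed a pipe x and
   lies to its left runs straight down until x has left the array, and a path
   going up along z forces one going up along x. *)

(** * Two-row transfer *)

Definition vert (t : tile) : bool := (t == Pivot) || (t == Elbow).

(* l, b, r, u tell whether a path uses the left, bottom, right and upper edge
   of the box. *)
Definition flow (t : tile) (l b r u : bool) : bool :=
  match t with
  | Pivot => [&& ~~ l, ~~ b & r (+) u]
  | Elbow => [&& ~~ (l && b), ~~ (r && u) & (l || b) == (r || u)]
  | _ => (l == r) && (b == u)
  end.

Lemma flow_straight t l b r u :
  ~~ vert t -> flow t l b r u = (l == r) && (b == u).
Proof. by case: t. Qed.

Lemma vert_elbow t : vert t -> t <> Pivot -> t = Elbow.
Proof. by case: t. Qed.

Lemma downward_ind (n : nat) (P : nat -> Prop) :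
  P n -> (forall c, c < n -> P c.+1 -> P c) -> forall c, c <= n -> P c.
Proof.
move=> Pn Pst c lecn; rewrite -(subKn lecn); elim: (n - c) (leq_subr c n) => [|d IHd] led.
  by rewrite subn0.
by apply: Pst; [lia | rewrite -subSn // subSS; apply: IHd; lia].
Qed.

(** Glues local simulation steps into a whole run: [st] is the transition of the automaton whose run
    is built, and [R c] is the invariant tying its state at column [c] to the given run. *)
Lemma simulate_forward (S : Type) (n : nat) (R : nat -> S -> Prop)
    (st : nat -> S -> S -> Prop) (t0 : S) :
  R 0 t0 ->
  (forall c t, c < n -> R c t -> exists t', st c t t' /\ R c.+1 t') ->
  exists t : nat -> S,
    [/\ t 0 = t0, forall c, c < n -> st c (t c) (t c.+1) & R n (t n)].
Proof.
move=> R0; elim: n => [|n IHn] Rst; first by exists (fun=> t0).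
have [|t [tE tst Rt]] := IHn; first by move=> c t /ltnW; apply: Rst.
have [t' [stt' Rt']] := Rst n _ (leqnn _) Rt.
exists (fun c => if c <= n then t c else t'); split=> //; last by rewrite ltnn.
move=> c /=; rewrite ltnS leq_eqVlt => /predU1P[->|ltcn]; first by rewrite eqxx ltnn.
by rewrite ltcn orbT; apply: tst.
Qed.

Lemma simulate_backward (S : Type) (n : nat) (R : nat -> S -> Prop)
    (st : nat -> S -> S -> Prop) (t0 : S) :
  R n t0 ->
  (forall c t', c < n -> R c.+1 t' -> exists t, st c t t' /\ R c t) ->
  exists t : nat -> S,
    [/\ t n = t0, forall c, c < n -> st c (t c) (t c.+1) & R 0 (t 0)].
Proof.
move=> Rn Rst.
(* The forward version applies once column [c] is replaced by [n - c]. *)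
have [||t [tE tst Rt]] := @simulate_forward S n (fun c => R (n - c))
  (fun c t t' => st (n - c.+1) t' t) t0; first by rewrite subn0.
  move=> c t ltcn Rt; have [||t' stt'] := Rst (n - c.+1) t; first by lia.
    by rewrite -subSn // subSS.
  by exists t'.
exists (fun c => t (n - c)); split; rewrite ?subnn ?subn0 //; last by rewrite subnn in Rt.
move=> c ltcn; have /(tst _) : n - c.+1 < n by lia.
by rewrite -!subSn ?subSS ?subKn //; lia.
Qed.

Section Row.

Variables (n : nat) (B : nat -> tile) (I : nat -> bool).

(* Necessary for a path to enter column c horizontally in row B: this is the
   vertex where the path arrives, hence free of paths from below. *)
Definition free_next c : Prop :=
  exists j, [/\ c <= j < n, vert (B j), ~~ I j
              & forall l, c <= l < j -> ~~ vert (B l)].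

Lemma free_next_step c : c < n -> ~~ vert (B c) -> free_next c.+1 -> free_next c.
Proof.
move=> ltcn nB [j [cj Bj Ij nBl]]; exists j; split=> //; first lia.
move=> l /andP[]; rewrite leq_eqVlt => /predU1P[<-//|cl lj]; apply: nBl; lia.
Qed.

(** A path on the left edge of a box either arrives at a vertex there, whose rule excludes a second
    path from below, or runs straight into the next column. *)
Lemma free_next_row c (b b' m : bool) : c < n -> (b' -> free_next c.+1) ->
  flow (B c) b (I c) b' m -> b -> free_next c.
Proof.
move=> ltcn fr' fl tb; rewrite tb in fl; case: (boolP (vert (B c))) => [Bc | nBc].
  exists c; split=> //; [lia | by move: Bc fl; case: (B c) => //; case: (I c) | lia].
by move: fl; rewrite flow_straight // => /andP[/eqP/esym/fr' fr _]; apply: free_next_step.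
Qed.


(** Without vertices a horizontal path can only run straight, so it would leave through the right
    edge of the array. *)
Lemma last_column (ha : nat -> bool) (X : nat -> tile) (j : nat) :
  (forall c, j <= c < n -> ~~ vert (X c)) -> ~~ ha n ->
  (forall c, c < n -> exists m o, flow (X c) (ha c) m (ha c.+1) o) ->
  forall c, j <= c <= n -> ~~ ha c.
Proof.
move=> nX han fl c /andP[jc cn]; move: c cn jc; apply: downward_ind => // c cn IH jc.
have [m [o]] := fl _ cn.
by rewrite flow_straight ?nX ?jc // => /andP[/eqP-> _]; apply: IH; lia.
Qed.


End Row.

(** * The two automata and their simulations *)

Section TwoRows.

(** [A] and [B] are the upper and lower row of D, [A'] and [B'] those of st_i(D), [q] is the pivot
    column of the lower row of D and [js] is j*. The edges below and above the two rows are
    prescribed by [I] and [O]. *)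
Variables (n q js : nat) (A B A' B' : nat -> tile) (I O : nat -> bool).

(** [m] is the edge between the two rows. Letting it range over an explicit list keeps the relation
    boolean, so that a simulation step is a finite check once the tiles are known. *)
Definition step2 (X Y : nat -> tile) c (s s' : bool * bool) : bool :=
  has (fun m => flow (X c) s.1 m s'.1 (O c) && flow (Y c) s.2 (I c) s'.2 m)
      [:: true; false].

Definition run2 (X Y : nat -> tile) : Prop :=
  exists s : nat -> bool * bool,
    [/\ s 0 = (false, false), s n = (false, false)
      & forall c, c < n -> step2 X Y c (s c) (s c.+1)].

Hypotheses (ltqn : q < n) (leqj : q <= js) (lejn : js <= n).
Hypothesis A_gt : forall c, q < c < n -> A c <> Pivot.
Hypotheses (B_lt : forall c, c < q -> ~~ vert (B c)) (B_q : B q = Pivot).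
Hypothesis B_gt : forall c, q < c < n -> B c <> Pivot.
Hypothesis A_q : q < js -> A q = Elbow.
Hypothesis AB_mid : forall c, q < c < js -> vert (B c) -> vert (A c).
Hypothesis A_ge : forall c, js <= c < n -> ~~ vert (A c).
Hypothesis B_js : q < js < n -> B js = Elbow.
(** The noncrossing of disjoint paths, in the form needed where an elbow lies above a cross;
    [cross_not_crossed] provides it. *)
Hypothesis no_crossing : forall c, q < c < js -> vert (A c) ->
  ~~ vert (B c) -> I c -> ~ free_next n B I c.+1.
Hypothesis A'_lt : forall c, c < q -> ~~ vert (A' c).
Hypothesis B'_lt : forall c, c < q -> B' c = A c.
Hypotheses (A'_q : A' q = Pivot) (B'_q : ~~ vert (B' q)).
Hypothesis A'_mid : forall c, q < c < js -> A' c = A c.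
Hypothesis B'_mid : forall c, q < c < js -> B' c = B c.
Hypothesis A'_js : q < js < n -> A' js = Elbow.
Hypothesis B'_js : q < js < n -> B' js = Elbow.
Hypothesis A'_gt : forall c, js < c < n -> A' c = B c.
Hypothesis B'_gt : forall c, js < c < n -> ~~ vert (B' c).

(* Between column q and column js a lone path of D in the lower row may appear
   in D' in the upper row; beyond js the upper row of D and the lower row of D'
   have no vertices left, so the remaining path has changed rows. *)
Definition sim c (s t : bool * bool) : bool :=
  if c <= q then [&& ~~ s.2, ~~ t.1 & s.1 == t.2]
  else if c <= js then (t == s) || (s == (false, true)) && (t == (true, false))
  else [&& ~~ s.1, ~~ t.2 & s.2 == t.1].

Lemma sim_step_forward c s s' t : c < n -> sim c s t -> step2 A B c s s' ->
  (js <= c -> ~~ s.1) ->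
  (s'.2 -> free_next n B I c.+1) ->
  exists t', step2 A' B' c t t' /\ sim c.+1 s' t'.
Proof.
move=> ltcn; rewrite /sim /step2; case: s s' t => [s1 s2] [s1' s2'] [t1 t2] /=.
case: (ltngtP c q) => [ltcq|gtcq|eqcq].
- rewrite B'_lt // => /and3P[/negbTE-> /negbTE-> /eqP->] st _ _.
  exists (false, s1'); move: st; rewrite /= !(flow_straight _ _ _ _ (B_lt ltcq)).
  rewrite !(flow_straight _ _ _ _ (A'_lt ltcq)).
  by case: (O c) (I c) s2' s1' => [] [] [] []; rewrite /= ?andbF ?andbT ?orbF ?orbT ?eqxx.
- case: (ltngtP c js) => [ltcj|gtcj|eqcj].
  + have cmid : q < c < js by rewrite gtcq.
    rewrite A'_mid ?B'_mid // => /orP[/eqP[-> ->]|/andP[/eqP[-> ->] /eqP[-> ->]]] st _ fr.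
      by exists (s1', s2'); rewrite st eqxx.
    (* The path of D' stays in the exchanged row as long as D keeps a lone path in its lower row;
       otherwise the two runs coincide again. *)
    exists (if (s1', s2') == (false, true) then (true, false) else (s1', s2')).
    have nc := no_crossing cmid; have mid := AB_mid cmid.
    have ltcn' : q < c < n by rewrite gtcq.
    have vA := @vert_elbow _ ^~ (A_gt _); have vB := @vert_elbow _ ^~ (B_gt ltcn').
    case: (boolP (vert (B c))) => [Bc|nB].
      move: st; rewrite (vB Bc) (vert_elbow (mid Bc)) /=; last by apply: A_gt; lia.
      by move: (O c) (I c) s2' s1' {fr nc} => [] [] [] [].
    move: st nc; rewrite !(flow_straight _ _ _ _ nB).
    case: (boolP (vert (A c))) => [Ac|nA].
      rewrite (vert_elbow Ac) /=; last by apply: A_gt; lia.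
      (* In D' the upper elbow is entered from the left, so it cannot also receive a path from
         below. Such a path is excluded by [no_crossing], as the lower path of D goes on into the
         next column. *)
      move: (O c) (I c) s2' s1' fr => [] [] [] [] //= fr _ /(_ isT nB isT); case; exact: fr.
    rewrite !(flow_straight _ _ _ _ nA).
    by move: (O c) (I c) s2' s1' {fr} => [] [] [] [] //=.
  + have cgt : js < c < n by rewrite gtcj.
    rewrite A'_gt // => /and3P[/negbTE-> /negbTE-> /eqP->] st _ _.
    exists (s2', false); move: st; rewrite !(flow_straight _ _ _ _ (B'_gt cgt)).
    have nA : ~~ vert (A c) by apply: A_ge; rewrite ltnW.
    rewrite !(flow_straight _ _ _ _ nA) /=.
    move: (flow (B c) t1) => f; move: (O c) (I c) s1' s2' => [] [] [] [];
    by rewrite /= ?andbT ?andbF ?orbF.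
  + have cjs : q < js < n by rewrite -eqcj gtcq.
    have nA : ~~ vert (A js) by apply: A_ge; rewrite leqnn -eqcj.
    rewrite eqcj !(flow_straight _ _ _ _ nA) B_js // A'_js // B'_js // => sm st /(_ isT) ns1 _.
    (* In column [js] the lower elbow of D' is made to send any path it receives up to the upper
       elbow, so nothing continues in the lower row. *)
    exists (s2', false); move: sm ns1 st.
    by move: (O js) (I js) s1 s2 t1 t2 s1' s2' => [] [] [] [] [] [] [] [].
- rewrite eqcq B_q A'_q => sm st ns1 _.
  case: (ltngtP q js) leqj => [ltqj|//|eqj] _.
    move: sm st; rewrite A_q //=.
    (* This state is forced: the upper pivot of D' goes right unless it takes the edge above, and
       the lower path passes straight. The exchanged state arises here, when [s1] and [O q] are
       false and the pivot path of D goes right. *)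
    exists (~~ O q, s1); rewrite !(flow_straight _ _ _ _ B'_q); move: sm st.
    by move: (O q) (I q) s1 s2 t1 t2 s1' s2' {ns1} => [] [] [] [] [] [] [] [].
  have /negbTE s1F := ns1 ltac:(by rewrite -eqj).
  have nA : ~~ vert (A q) by apply: A_ge; rewrite -eqj leqnn.
  rewrite !(flow_straight _ _ _ _ nA) in st.
  exists (s2', false); rewrite !(flow_straight _ _ _ _ B'_q).
  move: sm st; rewrite s1F.
  by move: (O q) (I q) s2 t1 t2 s1' s2' => [] [] [] [] [] [] [].
Qed.

Lemma sim_step_backward c s' t t' : c < n -> sim c.+1 s' t' ->
  step2 A' B' c t t' -> (c <= q -> ~~ t.1) -> (js <= c -> q < c -> ~~ t'.2) ->
  (js < c \/ js = q /\ c = q -> ~~ t.2) ->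
  (s'.2 -> free_next n B I c.+1) ->
  exists s, step2 A B c s s' /\ sim c s t.
Proof.
move=> ltcn; rewrite /sim /step2; case: s' t t' => [s1' s2'] [t1 t2] [t1' t2'] /=.
case: (ltngtP c q) => [ltcq|gtcq|eqcq].
- rewrite B'_lt // => /and3P[/negbTE-> /negbTE-> /eqP->] st /(_ isT)/negbTE t1F _ _ _.
  exists (t2, false); move: st; rewrite t1F /= !(flow_straight _ _ _ _ (B_lt ltcq)).
  rewrite !(flow_straight _ _ _ _ (A'_lt ltcq)) eqxx.
  by move: (O c) (I c) => [] []; rewrite /= ?andbT ?andbF ?orbF // => ->.
- case: (ltngtP c js) => [ltcj|gtcj|eqcj].
  + have cmid : q < c < js by rewrite gtcq.
    rewrite A'_mid ?B'_mid // => /orP[/eqP[-> ->]|/andP[/eqP[-> ->] /eqP[-> ->]]] st _ _ _ fr.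
      by exists (t1, t2); rewrite st eqxx.
    exists (if (t1, t2) == (true, false) then (false, true) else (t1, t2)).
    have nc := no_crossing cmid; have mid := AB_mid cmid.
    have ltcn' : q < c < n by rewrite gtcq.
    case: (boolP (vert (B c))) => [Bc|nB].
      move: st; rewrite (vert_elbow Bc (B_gt ltcn')) (vert_elbow (mid Bc)) /=; last by apply: A_gt; lia.
      by move: (O c) (I c) t1 t2 {fr nc} => [] [] [] [].
    move: st nc; rewrite !(flow_straight _ _ _ _ nB).
    case: (boolP (vert (A c))) => [Ac|nA].
      rewrite (vert_elbow Ac) /=; last by apply: A_gt; lia.
      move: (O c) (I c) t1 t2 fr => [] [] [] [] //= fr _ /(_ isT nB isT); case; exact: fr.
    rewrite !(flow_straight _ _ _ _ nA).
    by move: (O c) (I c) t1 t2 {fr} => [] [] [] [] //=.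
  + have cgt : js < c < n by rewrite gtcj.
    rewrite A'_gt // => /and3P[/negbTE-> /negbTE-> /eqP->] st _ _ /(_ (or_introl isT))/negbTE t2F _.
    exists (false, t1); move: st; rewrite !(flow_straight _ _ _ _ (B'_gt cgt)) t2F.
    have nA : ~~ vert (A c) by apply: A_ge; rewrite ltnW.
    rewrite !(flow_straight _ _ _ _ nA) /=.
    move: (flow (B c) t1) => f; move: (O c) (I c) => [] [];
    by rewrite /= ?andbT ?andbF ?orbF.
  + have cjs : q < js < n by rewrite -eqcj gtcq.
    have nA : ~~ vert (A js) by apply: A_ge; rewrite leqnn -eqcj.
    rewrite eqcj B_js // A'_js // B'_js //.
    move=> sm st _ /(_ isT isT) nt2' _ _.
    (* At most one of [t1] and [t2] holds: a path entering the lower elbow of D' must go up, into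
       the upper elbow. *)
    exists (false, t1 || t2); rewrite !(flow_straight _ _ _ _ nA); move: sm nt2' st.
    by move: (O js) (I js) s1' s2' t1 t2 t1' t2' => [] [] [] [] [] [] [] [].
- rewrite eqcq B_q A'_q !(flow_straight _ _ _ _ B'_q) => sm st /(_ isT) nt1 _ nt2 _.
  case: (ltngtP q js) leqj sm => [ltqj|//|eqj] _ sm.
    rewrite A_q //=.
    exists (t2, false); move: sm st.
    by move: (O q) (I q) s1' s2' t1 t2 t1' t2' {nt2} nt1 => [] [] [] [] [] [] [] [].
  have /negbTE t2F := nt2 (or_intror (conj (esym eqj) (erefl q))).
  have nA : ~~ vert (A q) by apply: A_ge; rewrite -eqj leqnn.
  exists (false, false); rewrite !(flow_straight _ _ _ _ nA).
  rewrite t2F in st *; move: sm st nt1.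
  by move: (O q) (I q) t1 s1' s2' t1' t2' => [] [] [] [] [] [] [].
Qed.

Lemma run2_forward : run2 A B -> run2 A' B'.
Proof.
move=> [s [s0 sn st]].
have fr : forall c, c <= n -> (s c).2 -> free_next n B I c.
  apply: downward_ind => [|c ltcn IHc]; first by rewrite sn.
  have /hasP[m _ /andP[_ fB]] := st _ ltcn; exact: free_next_row fB.
have sA c : js <= c <= n -> ~~ (s c).1.
  move: c; apply: last_column A_ge _ _; first by rewrite sn.
  by move=> c /st/hasP[m _ /andP[fA _]]; exists m, (O c).
pose R c t := sim c (s c) t.
have [|c t ltcn Rt|t [t0 tst]] := @simulate_forward _ n R (step2 A' B') (false, false).
- by rewrite /R /sim s0.
- apply: sim_step_forward Rt (st _ ltcn) _ (fr _ ltcn) => // jc; apply: sA; lia.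
rewrite /R /sim sn leqNgt ltqn /= => simn; exists t; split=> //.
by move: simn; case: ifP => _; case: (t n) => [] [] [].
Qed.

(** Now the run of D is the one to be built, so [free_next], which looks at the columns further
    right, has to be part of the invariant. This is why the construction goes from right to left. *)
Lemma run2_backward : run2 A' B' -> run2 A B.
Proof.
move=> [t [t0 tn st]].
have tA : forall c, c <= q -> ~~ (t c).1.
  elim=> [|c IHc] cq; first by rewrite t0.
  have ltcn : c < n by lia.
  have /hasP[m _ /andP[]] := st _ ltcn.
  by rewrite (flow_straight _ _ _ _ (A'_lt cq)) => /andP[/eqP<-]; rewrite IHc // ltnW.
pose R c s := sim c s (t c) /\ (s.2 -> free_next n B I c).
have tB c : js < c <= n -> ~~ (t c).2.
  move: c; apply: last_column B'_gt _ _; first by rewrite tn.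
  by move=> c /st/hasP[m _ /andP[_ fB]]; exists (I c), m.
have [|c s' ltcn [simc fr]|s [sn sst [sim0 _]]] :=
  @simulate_backward _ n R (step2 A B) (false, false).
- by rewrite /R /sim tn leqNgt ltqn /=; case: ifP.
- have [|||s [sts sims]] := sim_step_backward ltcn simc (st _ ltcn) _ _ _ fr.
  + exact: tA.
  + by move=> jc qc; apply: tB; lia.
  + case=> [jc|[jq cq]]; first by apply: tB; lia.
    have /hasP[m _ /andP[_]] := st _ ltcn.
    rewrite cq (flow_straight _ _ _ _ B'_q) => /andP[/eqP-> _]; apply: tB; lia.
  exists s; split=> //; split=> //.
  by have /hasP[m _ /andP[_ fB]] := sts; exact: free_next_row fB.
exists s; split=> //; move: sim0; rewrite /sim t0 /=.
by case: (s 0) => [] [] [].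
Qed.

End TwoRows.

(** * Pipe labels *)

(** Natural number indices let labels and automata sweep rows by plain recursion; the default
    [Empty] is not a vertex. *)
Definition tile_at k n (M : 'M[tile]_(k, n)) (r c : nat) : tile :=
  oapp (fun i => oapp (M i) Empty (insub c)) Empty (insub r).

Lemma tile_atE k n (M : 'M[tile]_(k, n)) (i : 'I_k) (j : 'I_n) :
  tile_at M i j = M i j.
Proof. by rewrite /tile_at !valK. Qed.

Section Labels.

Variables (n : nat) (V : nat -> nat -> bool).

(* The label of a pipe is its starting column; None means that no pipe crosses
   the edge.  A vertex tile sends the left pipe down and the top pipe right, and
   every other tile lets the labels go straight. *)
Fixpoint row_label (W : nat -> bool) (t : nat -> option 'I_n) c : option 'I_n :=
  if c is c'.+1 then if W c' then t c' else row_label W t c' else None.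

Fixpoint top_label r : nat -> option 'I_n :=
  if r is r'.+1 then
    fun c => if V r' c then row_label (V r') (top_label r') c else top_label r' c
  else insub.

Definition left_label r := row_label (V r) (top_label r).

Lemma left_label_origin r c y : left_label r c = Some y ->
  exists c0, [/\ c0 < c, V r c0, top_label r c0 = Some y
    & forall l, c0 < l < c -> ~~ V r l].
Proof.
rewrite /left_label; elim: c => //= c IHc; case: ifPn => [Vc tc|nVc /IHc[c0 [lt0 V0 t0 n0]]].
  by exists c; split=> // l; lia.
exists c0; split=> // [|l /andP[lt0l]]; first exact: ltnW.
by rewrite ltnS leq_eqVlt => /predU1P[->//|ltl]; apply: n0; rewrite lt0l.
Qed.

Lemma left_label_skip r c d : c <= d -> (forall l, c <= l < d -> ~~ V r l) ->
  left_label r d = left_label r c.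
Proof.
move=> /subnK <-; elim: (d - c) => //= e IHe nV; rewrite /left_label /= ifN.
  by apply: IHe => l ll; apply: nV; lia.
by apply: nV; lia.
Qed.

(** A label below row [r] comes from a top label of row [r]: under a vertex, from the nearest vertex
    to its left; elsewhere, from the same column. Both origins are injective in the column, and one
    is a vertex while the other is not. *)
Lemma top_label_inj r c1 c2 p :
  top_label r c1 = Some p -> top_label r c2 = Some p -> c1 = c2.
Proof.
elim: r c1 c2 => [|r IHr] c1 c2 /=.
  by case: insubP => // x _ <- [->]; case: insubP => // y _ <- [->].
have mixed a b : V r a -> ~~ V r b -> left_label r a = Some p ->
    top_label r b = Some p -> a = b.
  move=> Va nVb /left_label_origin[a0 [_ Va0 ta0 _]] tb.
  by rewrite -(IHr _ _ ta0 tb) Va0 in nVb.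
case: ifPn => V1; case: ifPn => V2 t1 t2; last exact: IHr t1 t2.
- have [a1 [lt1 Va1 ta1 n1]] := left_label_origin t1.
  have [a2 [lt2 Va2 ta2 n2]] := left_label_origin t2.
  have eqa := IHr _ _ ta1 ta2; subst a2.
  case: (ltngtP c1 c2) => // ltc.
    by have := n2 c1; rewrite lt1 ltc V1 => /(_ isT).
  by have := n1 c2; rewrite lt2 ltc V2 => /(_ isT).
- exact: mixed t1 t2.
- by symmetry; apply: mixed t2 t1.
Qed.

(** Labels increase along the top of the array. Going up one row from an inversion, either the
    inversion persists or the two pipes cross in that row. *)
Lemma inversion_crossing r c1 c2 (p1 p2 : 'I_n) :
  top_label r c1 = Some p1 -> top_label r c2 = Some p2 -> c1 < c2 -> p2 < p1 ->
  exists r0 c0, [/\ r0 < r, c0 < c2, ~~ V r0 c0,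
    left_label r0 c0 = Some p2 & top_label r0 c0 = Some p1].
Proof.
elim: r c1 c2 => [|r IHr] c1 c2 /=.
  by case: insubP => // x _ <- [->]; case: insubP => // y _ <- [->] /ltnW; rewrite leqNgt => /negbTE->.
move=> t1 t2 lt12 lt21.
have up a1 a2 : top_label r a1 = Some p1 -> top_label r a2 = Some p2 ->
    a1 < a2 -> a2 <= c2 ->
  exists r0 c0, [/\ r0 < r.+1, c0 < c2, ~~ V r0 c0,
    left_label r0 c0 = Some p2 & top_label r0 c0 = Some p1].
  move=> ta1 ta2 lta lea; have [r0 [c0 [ltr ltc nV l t]]] := IHr _ _ ta1 ta2 lta lt21.
  by exists r0, c0; split=> //; [apply: ltnW | apply: leq_trans lea].
move: t1 t2; case: ifPn => V1; case: ifPn => V2 t1 t2.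
- have [a1 [lta1 Va1 ta1 n1]] := left_label_origin t1.
  have [a2 [lta2 Va2 ta2 n2]] := left_label_origin t2.
  apply: up ta1 ta2 _ _; last exact: ltnW.
  rewrite ltnNge; apply/negP => le21.
  by have := n2 c1; rewrite V1; lia.
- have [a1 [lta1 Va1 ta1 n1]] := left_label_origin t1.
  by apply: up ta1 t2 _ _; lia.
- have [a2 [lta2 Va2 ta2 n2]] := left_label_origin t2.
  case: (ltngtP c1 a2) => [lt|gt|eq]; first by apply: up t1 ta2 _ _; lia.
    (* Here [p2] starts at a vertex left of column [c1] and runs horizontally across it, where [p1]
       comes straight down. *)
    exists r, c1; split=> //; rewrite -t2; symmetry; apply: left_label_skip; first exact: ltnW.
    by move=> l /andP[l1 l2]; apply: n2; rewrite l2 (leq_trans gt).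
  by rewrite eq Va2 in V1.
- by apply: up t1 t2 _ _; lia.
Qed.

End Labels.

(** * Labels agree with pipes in a Rothe pipe dream *)

Section Rothe.

Variables (n : nat) (u : 'S_n) (F : 'M[tile]_n).
Hypothesis rotheF : rothe_pipe_dream u F.

Let V r c := vert (tile_at F r c).

Variant rothe_spec (i j : 'I_n) : tile -> Prop :=
| RothePivot of j = u i : rothe_spec i j Pivot
| RotheEmpty of (u^-1)%g j < i & j < u i : rothe_spec i j Empty
| RotheHorizontal of (u^-1)%g j < i & u i < j : rothe_spec i j Horizontal
| RotheVertical of i < (u^-1)%g j & j < u i : rothe_spec i j Vertical
| RotheCross of i < (u^-1)%g j & u i < j : rothe_spec i j Cross
| RotheElbow of i < (u^-1)%g j & u i < j : rothe_spec i j Elbow.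

Lemma rotheP i j : rothe_spec i j (F i j).
Proof.
case: (eqVneq j (u i)) => [->|neq]; first by rewrite (rothe_pivot rotheF); constructor.
case: (ltngtP j (u i)) => [ltj|gtj|/val_inj eqj]; last by rewrite eqj eqxx in neq.
  case: (ltngtP ((u^-1)%g j) i) => [lti|gti|/val_inj eqi].
  - by rewrite (rothe_empty rotheF lti ltj); constructor.
  - by rewrite (rothe_vertical rotheF gti ltj); constructor.
  - by rewrite -eqi permKV eqxx in neq.
case: (ltngtP ((u^-1)%g j) i) => [lti|gti|/val_inj eqi].
- by rewrite (rothe_horizontal rotheF lti gtj); constructor.
- by case: (rothe_other rotheF gti gtj) => ->; constructor.
- by rewrite -eqi permKV eqxx in neq.
Qed.

(** Induction along the row from knowledge of its top edges; [rothe_top_exists] supplies that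
    knowledge by induction on the rows. *)
Lemma rothe_left_exists (i : 'I_n) :
  (forall j : 'I_n, top_label n V i j = (i <= (u^-1)%g j) :> bool) ->
  forall c, c <= n -> left_label n V i c = (u i < c) :> bool.
Proof.
move=> topE; elim=> // c IHc ltcn; rewrite /left_label /= -/(left_label n V i c).
have := topE (Ordinal ltcn); rewrite /= => tE.
rewrite [V i c](congr1 vert (tile_atE F i (Ordinal ltcn))) ltnS.
case: (rotheP i (Ordinal ltcn)) tE => /=.
- by move=> eqj ->; rewrite eqj permK -eqj /= !leqnn.
- by move=> _ lt _; rewrite (IHc (ltnW ltcn)); lia.
- by move=> _ lt _; rewrite (IHc (ltnW ltcn)); lia.
- by move=> _ lt _; rewrite (IHc (ltnW ltcn)); lia.
- by move=> _ lt _; rewrite (IHc (ltnW ltcn)); lia.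
- by move=> lt1 lt2 ->; lia.
Qed.

Lemma rothe_top_exists (r : nat) (j : 'I_n) : r <= n ->
  top_label n V r j = (r <= (u^-1)%g j) :> bool.
Proof.
elim: r j => [|r IHr] j ltrn /=; first by rewrite valK.
rewrite -/(left_label n V r j).
have lE := @rothe_left_exists (Ordinal ltrn) (fun j => IHr j (ltnW ltrn)) j (ltnW (ltn_ord j)).
rewrite /= in lE; rewrite [V r j](congr1 vert (tile_atE F (Ordinal ltrn) j)).
move: lE; have := IHr j (ltnW ltrn).
case: (rotheP (Ordinal ltrn) j) => /=.
- by move=> -> _ ->; rewrite permK !ltnn.
- by move=> lt _ -> _; lia.
- by move=> lt _ -> _; lia.
- by move=> lt _ -> _; lia.
- by move=> lt _ -> _; lia.
- by move=> lt lt2 _ ->; lia.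
Qed.

Lemma rothe_left_existsE (i : 'I_n) c : c <= n ->
  left_label n V i c = (u i < c) :> bool.
Proof. by apply: rothe_left_exists => j; apply/rothe_top_exists/ltnW. Qed.

(** A label goes straight through every tile that is not a vertex, whereas [enters] demands a pipe
    in that direction. The existence lemmas rule out the tiles where the two differ. *)
Lemma left_label_enters (i : 'I_n) (p : 'I_n) :
  (forall j : 'I_n, top_label n V i j = Some p -> enters F p i j Top) ->
  forall j : 'I_n, left_label n V i j = Some p -> enters F p i j Left.
Proof.
move=> topE [c ltcn] /=; elim: c ltcn => // c IHc ltcn.
have ltcn' := ltnW ltcn; have lE := rothe_left_existsE i (ltnW ltcn').
rewrite /left_label /= -/(left_label n V i c) => lp.
have tE := topE (Ordinal ltcn'); have lF := IHc ltcn'.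
have tS := @rothe_top_exists i (Ordinal ltcn') (ltnW (ltn_ord i)).
suff [s ent rt] : exists2 s, enters F p i (Ordinal ltcn') s
                  & route (F i (Ordinal ltcn')) s = Some Right.
  exact: enters_right ent rt _.
move: lp lE; rewrite [V i c](congr1 vert (tile_atE F i (Ordinal ltcn'))).
case: (rotheP i (Ordinal ltcn')) tE lF tS => /=.
- by move=> _ tE _ _ /tE; exists Top.
- by move=> _ lt _ _ _ -> /=; lia.
- by move=> _ _ _ lF _ /lF; exists Left.
- by move=> _ lt _ _ _ -> /=; lia.
- by move=> _ _ _ lF _ /lF; exists Left.
- by move=> _ _ tE _ _ /tE; exists Top.
Qed.

Lemma top_label_enters (i j p : 'I_n) :
  top_label n V i j = Some p -> enters F p i j Top.
Proof.
case: i => r ltrn /=; elim: r ltrn j => [|r IHr] ltrn j /=.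
  by rewrite valK => -[<-]; constructor.
have ltrn' := ltnW ltrn; rewrite -/(left_label n V r j) => tp.
have lE := rothe_left_existsE (Ordinal ltrn') (ltnW (ltn_ord j)).
have tE := rothe_top_exists j (ltnW ltrn').
have lF := @left_label_enters (Ordinal ltrn') p (IHr ltrn') j; have tF := IHr ltrn' j.
suff [s ent rt] : exists2 s, enters F p (Ordinal ltrn') j s
                  & route (F (Ordinal ltrn') j) s = Some Bottom.
  exact: enters_down ent rt _.
move: tp lE tE; rewrite [V r j](congr1 vert (tile_atE F (Ordinal ltrn') j)).
case: (rotheP (Ordinal ltrn') j) lF tF => /=.
- by move=> -> _ _ ->; rewrite ltnn.
- by move=> lt _ _ _ -> _ /=; lia.
- by move=> lt _ _ _ -> _ /=; lia.
- by move=> _ _ _ tF /tF; exists Top.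
- by move=> _ _ _ tF /tF; exists Top.
- by move=> _ _ lF _ /lF; exists Left.
Qed.

Lemma both_labels (i j : 'I_n) : left_label n V i j -> top_label n V i j ->
  F i j = Cross \/ F i j = Elbow.
Proof.
rewrite (rothe_left_existsE _ (ltnW (ltn_ord j))) (rothe_top_exists _ (ltnW (ltn_ord i))).
by case: (rotheP i j) => [->|||||]; try lia; auto.
Qed.

Lemma crossing_labels (i j : 'I_n) : F i j = Cross \/ F i j = Elbow ->
  left_label n V i j /\ top_label n V i j.
Proof.
rewrite (rothe_left_existsE _ (ltnW (ltn_ord j))) (rothe_top_exists _ (ltnW (ltn_ord i))).
by case: (rotheP i j) => [?|? ?|? ?|? ?|lt1 lt2|lt1 lt2] [] // _; split=> //; apply: ltnW.
Qed.

Hypothesis reducedF : reduced F.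
Hypothesis no_touchF : forall p q i j i' j' : 'I_n,
  cross_at F p q i j -> touch_at F p q i' j' -> ~ (i < i' /\ j < j').

(* This is all that is used of reducedness and of the condition on touching
   pipes. *)
Lemma meeting_order (i j x y : 'I_n) :
  left_label n V i j = Some x -> top_label n V i j = Some y -> x < y.
Proof.
move=> lx ty; rewrite ltnNge leq_eqVlt; apply/negP => /orP[/eqP/val_inj eqyx|ltyx].
  have [c0 [ltc0 _ tc0 _]] := left_label_origin lx.
  by rewrite eqyx in ty; rewrite (top_label_inj tc0 ty) ltnn in ltc0.
have [c0 [ltc0 _ tc0 _]] := left_label_origin lx.
have [r1 [c1 [ltr1 ltc1 nV l1 t1]]] := inversion_crossing tc0 ty ltc0 ltyx.
have ltrn : r1 < n by apply: ltn_trans (ltn_ord i).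
have ltcn : c1 < n by apply: ltn_trans (ltn_ord j).
have crossing (a b : 'I_n) : left_label n V a b -> top_label n V a b ->
    ~~ V a b -> F a b = Cross.
  by move=> la ta; rewrite /V tile_atE; case: (both_labels la ta) => ->.
pose a := Ordinal ltrn; pose b := Ordinal ltcn.
have cr : cross_at F x y a b.
  split; last first.
    left; split; first exact: top_label_enters.
    by apply: left_label_enters => // ?; apply: top_label_enters.
  by apply: crossing; rewrite ?l1 ?t1.
(* The earlier crossing lies strictly northwest of (i, j). A second cross contradicts reducedness,
   and an elbow the condition on touching pipes. *)
have [] : F i j = Cross \/ F i j = Elbow by apply: both_labels; rewrite ?lx ?ty.
  move=> Fij; have cr2 : cross_at F x y i j.
    split=> //; right; split; first exact: top_label_enters.
    by apply: left_label_enters => // ?; apply: top_label_enters.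
  by have [/(congr1 val) /= eqr _] := reducedF cr cr2; rewrite eqr ltnn in ltr1.
move=> Fij; apply: (no_touchF cr (i' := i) (j' := j)) => //.
split=> //; right; split; first exact: top_label_enters.
by apply: left_label_enters => // ?; apply: top_label_enters.
Qed.

End Rothe.

(** * Consequences of the order of meeting pipes *)

Section Noncrossing.

Variables (n k : nat) (T : nat -> nat -> tile).

Let V r c := vert (T r c).
Let left r c : option 'I_n := left_label n V r c.
Let top r c : option 'I_n := top_label n V r c.

Hypothesis meeting : forall r c (x y : 'I_n), r < k -> c < n ->
  left r c = Some x -> top r c = Some y -> x < y.
Hypothesis two_pipes : forall r c, r < k -> c < n ->
  T r c = Cross \/ T r c = Elbow -> left r c /\ top r c.
Hypothesis pivot_left : forall r c, r < k -> c < n ->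
  T r c = Pivot -> left r c = None.

(** To the right of a vertex labels only grow: at an elbow the left label is replaced by the top
    one, which is larger by [meeting]. *)
Lemma left_label_ge r c0 c z : r < k -> V r c0 -> top r c0 = Some z ->
  c0 < c <= n -> exists2 y : 'I_n, left r c = Some y & z <= y.
Proof.
move=> ltrk V0 t0; elim: c => // c IHc /andP[]; rewrite ltnS leq_eqVlt => /predU1P[<-|lt0] ltcn.
  by exists z; rewrite // /left /left_label /= V0.
have [|y ly lezy] := IHc; first by rewrite lt0 ltnW.
rewrite /left /left_label /= -/(left_label n V r c) -/(left r c).
case: ifPn => [Vc|_]; last by exists y.
have Tc : T r c = Elbow.
  by apply: vert_elbow Vc _ => /(pivot_left ltrk ltcn); rewrite ly.
have [_] := two_pipes ltrk ltcn (or_intror Tc).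
rewrite /top; case tc: top_label => [w|] // _; exists w => //.
exact: leq_trans lezy (ltnW (meeting ltrk ltcn ly tc)).
Qed.

(** If [z] turned right, the label arriving from the left in column [c2] would be at least [z],
    hence above [x], against [meeting]. *)
Lemma inverted_straight r c1 c2 (x z : 'I_n) : r < k -> c1 < c2 < n ->
  top r c1 = Some z -> top r c2 = Some x -> x < z -> ~~ V r c1.
Proof.
move=> ltrk /andP[lt12 ltn] t1 t2 ltxz; apply/negP => V1.
have [|y ly lezy] := left_label_ge (c := c2) ltrk V1 t1; first by rewrite lt12 ltnW.
have := meeting ltrk ltn ly t2; lia.
Qed.

(** Let [x] be the horizontal and [z] the vertical pipe at the cross, so [x < z]. At the next vertex
    of row [a], [x] would turn down and meet in row [a.+1] a label at least [z] coming from the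
    left, as [z] turns right below the cross. *)
Lemma vertex_below_cross a j c : a.+1 < k -> j < c < n ->
  T a j = Cross -> V a.+1 j -> ~~ V a c.
Proof.
move=> ltak /andP[ltjc ltcn] Taj Vbj.
have ltak' := ltnW ltak; have ltjn := ltn_trans ltjc ltcn.
have [] := two_pipes ltak' ltjn (or_introl Taj).
case lj: (left a j) => [x|] // _; case tj: (top a j) => [z|] // _.
have ltxz := meeting ltak' ltjn lj tj.
have nVj : ~~ V a j by rewrite /V Taj.
have tbj : top a.+1 j = Some z by rewrite /top /= (negbTE nVj).
have step d : j < d < n -> left a d = Some x -> ~~ V a d.
  move=> /andP[ltjd ltdn] ld; apply/negP => Vd.
  have [|y ly lezy] := left_label_ge (c := d) ltak Vbj tbj; first by rewrite ltjd ltnW.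
  have tbd : top a.+1 d = Some x by rewrite /top /= Vd.
  have := meeting ltak ltdn ly tbd; lia.
have lc : forall e, j < e <= c -> left a e = Some x.
  elim=> // e IHe /andP[]; rewrite ltnS leq_eqVlt => /predU1P[<-|ltje] ltec.
    by rewrite /left /left_label /= (negbTE nVj).
  have le : left a e = Some x by apply: IHe; rewrite ltje ltnW.
  rewrite /left /left_label /= ifN //; apply: step le.
  by rewrite ltje (leq_trans ltec) // ltnW.
by apply: step; rewrite ?lc ?ltjc ?leqnn.
Qed.

Variables (r0 : nat) (h v : nat -> nat -> bool).
Hypothesis h_end : forall r, r0 <= r < k -> ~~ h r n.
Hypothesis v_end : forall c, c < n -> ~~ v k c.
Hypothesis hv_flow : forall r c, r0 <= r < k -> c < n ->
  flow (T r c) (h r c) (v r.+1 c) (h r c.+1) (v r c).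

Lemma occupied_free_next r c : r0 <= r < k -> c <= n -> h r c ->
  free_next n (T r) (v r.+1) c.
Proof.
move=> rk; move: c; apply: downward_ind => [|c ltcn IHc].
  by rewrite (negbTE (h_end rk)).
exact: free_next_row ltcn IHc (hv_flow rk ltcn).
Qed.

(* Otherwise the column of z stays occupied in all rows below, since the pipe x,
   or one replacing it at an elbow, stays on its right at an unoccupied edge;
   but nothing enters the last row from below. *)
Lemma inverted_entries r j j2 (x z : 'I_n) : r0 <= r <= k -> j < j2 < n ->
  top r j = Some z -> top r j2 = Some x -> x < z -> v r j -> v r j2.
Proof.
case/andP=> + lerk; move: r lerk j j2 x z; apply: downward_ind => [|r ltrk IHr] j j2 x z.
  by move=> _ /andP[lt12 ltn] _ _ _ vj; have := v_end (ltn_trans lt12 ltn); rewrite vj.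
move=> le0r jj2 tj tj2 ltxz vj; have rk : r0 <= r < k by rewrite le0r.
have /andP[ltj ltj2n] := jj2; have ltjn := ltn_trans ltj ltj2n.
have nVj := inverted_straight ltrk jj2 tj tj2 ltxz.
have := hv_flow rk ltjn; rewrite flow_straight // vj => /andP[_ /eqP vj'].
have tj' : top r.+1 j = Some z by rewrite /top /= (negbTE nVj).
(* At the next vertex [j3] the pipe [x'] turns down, so it is again inverted with [z] one row below;
   by induction a path comes up there, against [free_next]. *)
have enter c (x' : 'I_n) : j < c -> left r c = Some x' -> x' < z ->
    free_next n (T r) (v r.+1) c -> False.
  move=> ltjc lc ltx' [j3 [/andP[lec3 lt3n] V3 /negP nv3 n3]]; apply: nv3.
  apply: (IHr j j3 x' z) => //; first exact: leqW; first by rewrite lt3n (leq_trans ltjc).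
  by rewrite /top /= [V r j3]V3; apply: etrans (@left_label_skip n V r _ _ lec3 n3) lc.
apply/negPn/negP => nv2; have fl2 := hv_flow rk ltj2n.
case: (boolP (V r j2)) => V2; last first.
  move: fl2; rewrite flow_straight // => /andP[_ /eqP v2].
  case/negP: nv2; rewrite -v2; apply: (IHr j j2 x z) => //; first exact: leqW.
  by rewrite /top /= (negbTE V2).
have l2S : left r j2.+1 = Some x by rewrite /left /left_label /= V2.
case: (boolP (h r j2.+1)) => h2.
  by apply: (enter j2.+1 x) => //; [apply: ltnW | apply: occupied_free_next].
case: (eqVneq (T r j2) Pivot) => [T2|/eqP T2].
  by move: fl2; rewrite T2 (negbTE h2) (negbTE nv2) /= !andbF.
have T2E := vert_elbow V2 T2.
have [] := two_pipes ltrk ltj2n (or_intror T2E).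
case l2: (left r j2) => [y|] // _ _.
(* No path leaves this elbow, so none enters it from below. The pipe [y] that turns down here takes
   the place of [x], with [y < x] by [meeting]. *)
apply: enter ltj l2 (ltn_trans (meeting ltrk ltj2n l2 tj2) ltxz) _.
exists j2; split=> //; [by rewrite leqnn | | lia].
by move: fl2; rewrite T2E (negbTE h2) (negbTE nv2) /= => /andP[_]; case: (v _ _); rewrite ?orbT.
Qed.

(** Below the cross, the vertical pipe is inverted with the horizontal one, which turns down at the
    next vertex. A path along the first forces one along the second, against [free_next]. Only the
    flow below row [r] enters, whence the bound [r0 <= r.+1]. *)
Lemma cross_not_crossed r c : r0 <= r.+1 -> r < k -> c < n -> T r c = Cross ->
  v r.+1 c -> ~ free_next n (T r) (v r.+1) c.+1.
Proof.
move=> le0 ltrk ltcn Tc vc [j [/andP[ltcj ltjn] Vj /negP nvj nV]]; apply: nvj.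
have [] := two_pipes ltrk ltcn (or_introl Tc).
case lc: (left r c) => [x|] // _; case tc: (top r c) => [z|] // _.
have nVc : ~~ V r c by rewrite /V Tc.
apply: (@inverted_entries _ c j x z) => //.
- by rewrite le0.
- by rewrite ltcj.
- by rewrite /top /= (negbTE nVc).
- rewrite /top /= [V r j]Vj; apply: etrans (@left_label_skip n V r _ _ ltcj nV) _.
  by rewrite /left_label /= (negbTE nVc).
- exact: meeting lc tc.
Qed.

End Noncrossing.

(** * Admissible collections as flows *)

Section Steps.

Variables (T : eqType).
Implicit Types (x y : T) (s : seq T).

(** The steps of the path [x :: s] are the members of [zip (x :: s) s]. *)
Lemma path_step (e : rel T) x s a b :
  path e x s -> (a, b) \in zip (x :: s) s -> e a b.
Proof.
elim: s x => //= y s IHs x /andP[exy]; rewrite inE => /IHs ps /predU1P[[-> ->]//|].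
exact: ps.
Qed.

Lemma mem_step x s a b :
  (a, b) \in zip (x :: s) s -> a \in x :: s /\ b \in s.
Proof.
elim: s x => //= y s IHs x; rewrite !inE => /predU1P[[-> ->]|/IHs[ay bs]].
  by rewrite !eqxx.
by rewrite bs orbT; move: ay; rewrite inE => ->; rewrite orbT.
Qed.

Lemma step_from x s a : a \in x :: s -> a != last x s ->
  exists b, (a, b) \in zip (x :: s) s.
Proof.
elim: s x => [|y s IHs] x /=; first by rewrite inE => /eqP->; rewrite eqxx.
rewrite inE => /predU1P[-> _|ay nal]; first by exists y; rewrite inE eqxx.
by have [b ab] := IHs _ ay nal; exists b; rewrite inE ab orbT.
Qed.

Lemma step_to x s b : b \in s -> exists a, (a, b) \in zip (x :: s) s.
Proof.
elim: s x => //= y s IHs x; rewrite inE => /predU1P[->|/(IHs y)[a ab]].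
  by exists x; rewrite inE eqxx.
by exists a; rewrite inE ab orbT.
Qed.

Lemma step_functional x s a b b' : uniq (x :: s) ->
  (a, b) \in zip (x :: s) s -> (a, b') \in zip (x :: s) s -> b = b'.
Proof.
elim: s x => //= y s IHs x /andP[xs us]; rewrite !inE.
move=> /predU1P[[eax ->]|ab] /predU1P[[eax' ->]|ab'] //.
- by case/mem_step: ab' xs => ay; rewrite -eax ay.
- by case/mem_step: ab xs => ay; rewrite -eax' ay.
- exact: IHs ab ab'.
Qed.

Lemma step_injective x s a a' b : uniq s ->
  (a, b) \in zip (x :: s) s -> (a', b) \in zip (x :: s) s -> a = a'.
Proof.
elim: s x => //= y s IHs x /andP[ys us]; rewrite !inE.
move=> /predU1P[[-> eby]|ab] /predU1P[[-> eby']|ab'] //.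
- by case/mem_step: ab' ys => _; rewrite -eby => ->.
- by case/mem_step: ab ys => _; rewrite -eby' => ->.
- exact: IHs ab ab'.
Qed.

End Steps.

(** [h r c] is the left edge and [v r c] the upper edge of box (r, c); thus [v 0] records the sinks
    reached and [v k] the bottom of the array. *)
Definition flow_config k n (M : 'M[tile]_(k, n)) (h v : nat -> nat -> bool) : Prop :=
  [/\ forall r : 'I_k, ~~ h r 0 /\ ~~ h r n, forall c : 'I_n, ~~ v k c
    & forall (r : 'I_k) (c : 'I_n),
        flow (M r c) (h r c) (v r.+1 c) (h r c.+1) (v r c)].

Section GraphFlow.

Variables (k n : nat) (M : 'M[tile]_(k, n)).
Local Notation node := (node k n).

(** Grows along every edge, since edges go right or up. Hence paths repeat no node and walks end. *)
Definition rank (x : node) : nat :=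
  match x with inl (i, j) => j + (k - i) | inr j => j + k.+1 end.

Lemma edge_rank x y : edge M x y -> rank x < rank y.
Proof.
case: x y => [[i j]|j] [[i' j']|j'] //=; rewrite /edge ?orbF /=.
  case/orP=> [/and5P[_ _ /eqP-> lt _]|].
    by rewrite ltn_add2l; have := ltn_ord i; lia.
  by case/and5P=> _ _ _ /eqP-> /andP[lt _]; lia.
by case/and3P=> _ /eqP-> _; lia.
Qed.

Lemma column_not_row x y : column_edge M x y -> ~~ row_edge M x y.
Proof.
case: x y => [[i j]|j] [[i' j']|j'] //= /and5P[_ _ _ lt _].
by apply/and5P => -[_ _ _ /eqP eqi]; rewrite eqi ltnn in lt.
Qed.

Hypothesis (pc : 'I_k -> 'I_n).
Hypothesis pivotM : forall i j, (M i j == Pivot) = (j == pc i).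

(** * From admissible collections to flows *)

Section PathsToFlow.

Variable P : 'I_k -> node * seq node.
Hypothesis admP : admissible_collection M P.

Definition used (x y : node) : bool :=
  [exists a, (x, y) \in zip ((P a).1 :: (P a).2) (P a).2].

Lemma mem_unique a b x : x \in (P a).1 :: (P a).2 -> x \in (P b).1 :: (P b).2 -> a = b.
Proof.
move=> xa xb; apply/eqP/negPn/negP => /(proj2 admP) []; by exists x.
Qed.

Lemma uniq_path a : uniq ((P a).1 :: (P a).2).
Proof.
have [_ pa _] := proj1 admP a.
have : path (relpre rank ltn) (P a).1 (P a).2 by apply: sub_path pa => x y /edge_rank.
have tr : transitive (relpre rank ltn) by move=> y x z; apply: ltn_trans.
exact: (sorted_uniq tr (fun x => ltnn (rank x))) (_ :: _).
Qed.

Lemma used_edge x y : used x y -> edge M x y.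
Proof. by case/existsP=> a; apply: path_step; case: (proj1 admP a). Qed.

Lemma used_functional x y y' : used x y -> used x y' -> y = y'.
Proof.
case/existsP=> a ua /existsP[b ub]; have [xa _] := mem_step ua.
have [xb _] := mem_step ub; rewrite -(mem_unique xa xb) in ub.
exact: step_functional (uniq_path a) ua ub.
Qed.

Lemma used_injective x x' y : used x y -> used x' y -> x = x'.
Proof.
case/existsP=> a ua /existsP[b ub]; have [_ ya] := mem_step ua.
have [_ yb] := mem_step ub.
have eqab : a = b by apply: (@mem_unique a b y); rewrite inE ?ya ?yb orbT.
rewrite -eqab in ub; apply: step_injective ua ub.
by have /andP[] := uniq_path a.
Qed.

Lemma used_from a (x : 'I_k * 'I_n) : inl x \in (P a).1 :: (P a).2 ->
  exists y, used (inl x) y.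
Proof.
move=> xa; have [_ _ [j lj]] := proj1 admP a.
have [|y uy] := step_from xa; first by rewrite lj.
by exists y; apply/existsP; exists a.
Qed.

(** There are as many paths as sources, one source per row, and disjoint paths start at distinct
    sources. *)
Lemma source_start i : exists a, (P a).1 = inl (i, pc i).
Proof.
have start a : exists i', (P a).1 = inl (i', pc i').
  have [] := proj1 admP a; case: (P a).1 => [[i' j]|j] //=.
  by rewrite pivotM => /eqP-> _ _; exists i'.
pose f a := if (P a).1 is inl (i', _) then i' else i.
have fE a : (P a).1 = inl (f a, pc (f a)).
  by rewrite /f; have [i' ->] := start a.
have injf : injective f.
  move=> a b eqf; apply: (@mem_unique a b (P a).1); rewrite ?mem_head //.
  by rewrite fE eqf -fE mem_head.
have [g _ gK] := injF_bij injf.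
by exists (g i); rewrite fE gK.
Qed.

Lemma used_source x y : is_source M y -> ~~ used x y.
Proof.
case: y => [[i j]|//] /=; rewrite pivotM => /eqP->.
have [a Pa] := source_start i; apply/existsP => -[b ub].
have [_ yb] := mem_step ub.
have eqab : a = b by apply: (@mem_unique a b (inl (i, pc i))); rewrite ?inE ?Pa ?eqxx // yb orbT.
by have /= := uniq_path b; rewrite -eqab Pa eqab yb.
Qed.

Lemma used_source_from i : exists y, used (inl (i, pc i)) y.
Proof.
by have [a Pa] := source_start i; apply: (@used_from a); rewrite Pa mem_head.
Qed.

Lemma used_balance (x : 'I_k * 'I_n) : ~~ is_source M (inl x) ->
  (exists y, used y (inl x)) <-> (exists y, used (inl x) y).
Proof.
move=> nx; split=> -[y /existsP[a ua]].
  by apply: (@used_from a); rewrite inE (proj2 (mem_step ua)) orbT.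
have xa : inl x \in (P a).2.
  have [] := mem_step ua; rewrite inE => /predU1P[xE|//].
  by have [] := proj1 admP a; rewrite -xE => /idPn; rewrite nx.
have [z uz] := step_to (P a).1 xa.
by exists z; apply/existsP; exists a.
Qed.

(** A graph edge occupies all box edges between its two ends; a sink lies above every row. *)
Definition ends_above (r : nat) (y : node) : bool :=
  if y is inl (i, _) then i < r else true.

Definition used_h (r c : nat) : bool :=
  [exists i : 'I_k, exists l : 'I_n, exists l' : 'I_n,
    [&& i == r :> nat, l < c <= l' & used (inl (i, l)) (inl (i, l'))]].

Definition used_v (r c : nat) : bool :=
  [exists i : 'I_k, exists j : 'I_n, exists y : node,
    [&& j == c :> nat, r <= i, used (inl (i, j)) y
      & ends_above r y]].

Lemma used_hP (r : 'I_k) c :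
  reflect (exists l l' : 'I_n, [/\ l < c, c <= l', used (inl (r, l)) (inl (r, l'))
     & row_edge M (inl (r, l)) (inl (r, l'))]) (used_h r c).
Proof.
apply: (iffP existsP) => [[i /existsP[l /existsP[l' /and3P[/eqP/val_inj-> /andP[lc cl] u]]]]|].
  exists l, l'; split=> //; case/orP: (used_edge u) => //= /and5P[_ _ _].
  by rewrite ltnn.
move=> [l [l' [lc cl u _]]]; exists r; apply/existsP; exists l; apply/existsP; exists l'.
by rewrite eqxx lc cl.
Qed.

Lemma used_vP r (c : 'I_n) :
  reflect (exists (i : 'I_k) y, [/\ r <= i, used (inl (i, c)) y,
     column_edge M (inl (i, c)) y
     & ends_above r y]) (used_v r c).
Proof.
apply: (iffP existsP) => [[i /existsP[j /existsP[y /and4P[/eqP/val_inj-> ri u ly]]]]|].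
  suff e : column_edge M (inl (i, c)) y by exists i, y.
  case/orP: (used_edge u) => //.
  case: y u ly => [[i' j']|j'] u lti //= /and5P[_ _ _ /eqP eqi].
  by rewrite /ends_above eqi ltnNge ri in lti.
move=> [i [y [ri u _ ly]]]; exists i; apply/existsP; exists c; apply/existsP; exists y.
by rewrite eqxx ri u.
Qed.

Section AtVertex.

Variables (r : 'I_k) (c : 'I_n).
Hypothesis vert_rc : is_vertex M r c.

Lemma used_h_in : reflect
  (exists2 x, used x (inl (r, c)) & row_edge M x (inl (r, c))) (used_h r c).
Proof.
apply: (iffP (used_hP r c)) => [[l [l' [lc cl u e]]]|[[[i l]|//] u /= /and5P[_ _ _ /eqP eqr]]].
  suff eqc : c = l' by rewrite eqc; exists (inl (r, l)).
  case/and5P: e => _ _ _ _ /andP[_ /forallP/(_ c)]; rewrite lc vert_rc implybF /=.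
  by rewrite -leqNgt => le; apply/val_inj/anti_leq; rewrite cl.
move=> /andP[lc nV]; rewrite eqr in u *; exists l, c; split=> //.
by case/orP: (used_edge u) => //= /and5P[_ _ _]; rewrite ltnn.
Qed.

Lemma used_h_out : reflect
  (exists2 y, used (inl (r, c)) y & row_edge M (inl (r, c)) y) (used_h r c.+1).
Proof.
apply: (iffP (used_hP r c.+1)) => [[l [l' [lc cl u e]]]|[[[i l]|//] u e]].
  suff eqc : c = l by rewrite eqc; exists (inl (r, l')).
  case/and5P: e => _ _ _ _ /andP[_ /forallP/(_ c)]; rewrite cl vert_rc andbT implybF.
  by rewrite -leqNgt => le; apply/val_inj/anti_leq; rewrite le -ltnS.
have := e; case/and5P=> _ _ _ /eqP eqr /andP[lt _].
by rewrite eqr in u e; exists c, l; split.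
Qed.

Lemma used_v_in : reflect
  (exists2 x, used x (inl (r, c)) & column_edge M x (inl (r, c))) (used_v r.+1 c).
Proof.
apply: (iffP (used_vP r.+1 c)) => [[i [y [ri u e ly]]]|[[[i l]|//] u e]].
  suff eqy : y = inl (r, c) by exists (inl (i, c)); rewrite -eqy.
  case: y u e ly => [[i' j']|j'] u e ly.
    case/and5P: e => _ _ /eqP eqj _ /forallP/(_ r).
    rewrite ri vert_rc andbT implybF -leqNgt => le.
    by rewrite eqj; congr (inl (_, _)); apply/val_inj/anti_leq; rewrite le andbT; exact: ly.
  by case/and3P: e => _ _ /forallP/(_ r); rewrite ri vert_rc.
have := e; case/and5P=> _ _ /eqP eqc lt _.
by rewrite -eqc in u e; exists i, (inl (r, c)); split=> //=.
Qed.

Lemma used_v_out : reflect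
  (exists2 y, used (inl (r, c)) y & column_edge M (inl (r, c)) y) (used_v r c).
Proof.
apply: (iffP (used_vP r c)) => [[i [y [ri u e ly]]]|[y u e]].
  suff eqi : i = r by rewrite -eqi; exists y.
  apply/val_inj/anti_leq; rewrite ri andbT leqNgt; apply/negP => lti.
  case: y u e ly => [[i' j']|j'] u e ly.
    case/and5P: e => _ _ _ _ /forallP/(_ r).
    by rewrite [_ < r]ly lti vert_rc.
  by case/and3P: e => _ _ /forallP/(_ r); rewrite lti vert_rc.
by exists r, y; split=> //; case: y u e => [[i' j']|//] _ /and5P[].
Qed.

Lemma used_in : (exists y, used y (inl (r, c))) <-> used_h r c || used_v r.+1 c.
Proof.
split=> [[y u]|/orP[/used_h_in|/used_v_in] [y u _]]; last by exists y.
  case/orP: (used_edge u) => e; apply/orP; [right|left].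
    by apply/used_v_in; exists y.
  by apply/used_h_in; exists y.
by exists y.
Qed.

Lemma used_out : (exists y, used (inl (r, c)) y) <-> used_h r c.+1 || used_v r c.
Proof.
split=> [[y u]|/orP[/used_h_out|/used_v_out] [y u _]]; last by exists y.
  case/orP: (used_edge u) => e; apply/orP; [right|left].
    by apply/used_v_out; exists y.
  by apply/used_h_out; exists y.
by exists y.
Qed.

Lemma used_out_unique : ~~ (used_h r c.+1 && used_v r c).
Proof.
apply/andP => -[/used_h_out[y u e] /used_v_out[y' u' e']].
by rewrite (used_functional u u') (negbTE (column_not_row e')) in e.
Qed.

Lemma used_in_unique : ~~ (used_h r c && used_v r.+1 c).
Proof.
apply/andP => -[/used_h_in[y u e] /used_v_in[y' u' e']].
by rewrite (used_injective u u') (negbTE (column_not_row e')) in e.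
Qed.

End AtVertex.

(** At a vertex the box edges in use are those of the graph edges of the path through it. Any other
    box is passed straight, because graph edges end only at vertices or sinks. *)
Lemma used_flow : flow_config M used_h used_v.
Proof.
split=> [r|c|r c].
- split; apply/negP => /used_hP[l [l' []]] //.
  by move=> _; rewrite leqNgt ltn_ord.
- by apply/negP => /used_vP[i [y []]]; rewrite leqNgt ltn_ord.
case: (boolP (is_vertex M r c)) => [vrc|nv].
  have bal := used_balance (x := (r, c)).
  have uin := used_in vrc; have uout := used_out vrc.
  have u1 := used_in_unique vrc; have u2 := used_out_unique vrc.
  case: (eqVneq (M r c) Pivot) => [Mrc|nM].
    have eqc : c = pc r by apply/eqP; rewrite -pivotM Mrc.
    have : ~ (used_h r c || used_v r.+1 c).
      by move/uin=> [y]; apply/negP/used_source; rewrite /= Mrc.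
    move=> /negP; rewrite negb_or => /andP[nh nv]; rewrite Mrc /= nh nv.
    have /uout : exists y, used (inl (r, c)) y by rewrite eqc; apply: used_source_from.
    by move: u2; case: (used_h r c.+1) (used_v r c) => [] [].
  have Mrc : M r c = Elbow by move: vrc; rewrite /is_vertex (negbTE nM) => /eqP.
  rewrite Mrc /= u1 u2 andTb; apply/eqP; apply/idP/idP.
    by move/uin/(bal nM)/uout.
  by move/uout/(bal nM)/uin.
rewrite flow_straight //; apply/andP; split; apply/eqP; apply/idP/idP.
- move=> /used_hP[l [l' [lc cl u e]]]; apply/used_hP; exists l, l'; split=> //.
    exact: ltnW.
  rewrite ltn_neqAle cl andbT; apply: contraNneq nv => /val_inj->.
  by case/and5P: e.
- move=> /used_hP[l [l' [lc cl u e]]]; apply/used_hP; exists l, l'; split=> //.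
    rewrite ltnS in lc; rewrite ltn_neqAle lc andbT.
    apply: contraNneq nv => /val_inj<-.
    by case/and5P: e.
  exact: ltnW.
- move=> /used_vP[i [y [ri u e ly]]]; apply/used_vP; exists i, y; split=> //.
    exact: ltnW.
  case: y u e ly => [[i' j']|//] u /and5P[_ v' /eqP eqc _ _]; rewrite /= ltnS => le.
  rewrite ltn_neqAle le andbT; apply: contraNneq nv => /val_inj<-.
  by rewrite -eqc.
- move=> /used_vP[i [y [ri u e ly]]]; apply/used_vP; exists i, y; split=> //.
    rewrite ltn_neqAle ri andbT; apply: contraNneq nv => /val_inj->.
    by case: y e {u ly} => [[i' j']|j'] /andP[].
  by case: y ly {u e} => [[i' j']|//] /ltnW.
Qed.

Lemma used_sink (j : 'I_n) : (j \in sink_set P) = used_v 0 j.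
Proof.
rewrite inE; apply/existsP/used_vP => [[a /eqP lj]|[i [y [_ u e]]]].
  have [src _ _] := proj1 admP a.
  have /step_to : inr j \in (P a).2.
    move: lj src; case: (P a) => x s /=; case/lastP: s => [/= -> //|s z].
    by rewrite last_rcons => -> _; rewrite mem_rcons mem_head.
  move=> /(_ (P a).1) [[[i c]|c] ua]; last first.
    have : used (inr c) (inr j) by apply/existsP; exists a.
    by move/used_edge.
  have u : used (inl (i, c)) (inr j) by apply/existsP; exists a.
  have := used_edge u; rewrite /edge orbF => e.
  have /eqP eqj : j == c by case/and3P: e.
  by rewrite -eqj in u e; exists i, (inr j); split.
case: y u e => [[//]|j'] u e _.
have /eqP eqj : j' == j by case/and3P: e.
case/existsP: u => a ua; exists a; apply/negPn/negP => nl.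
have [_ ja] := mem_step ua.
have [||z uz] := @step_from _ (P a).1 (P a).2 (inr j'); first by rewrite inE ja orbT.
  by rewrite eqj eq_sym.
have /used_edge : used (inr j') z by apply/existsP; exists a.
by [].
Qed.

End PathsToFlow.

(** * From flows to admissible collections *)

Section FlowToPaths.

Variables h v : nat -> nat -> bool.
Hypothesis hv_flow : flow_config M h v.

Definition occupied (x : node) : bool :=
  match x with
  | inl (i, j) => is_vertex M i j && (h i j.+1 || v i j)
  | inr j => v 0 j
  end.

Definition row_inflow (x : node) : bool :=
  if x is inl (i, j) then h i j else false.

Definition column_inflow (x : node) : bool :=
  match x with inl (i, j) => v i.+1 j | inr j => v 0 j end.

Definition goes_right (x : node) : bool :=
  if x is inl (i, j) then h i j.+1 else false.

(** The node to which the flow leads; by [next_spec] the default [x] does not occur at occupied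
    boxes. *)
Definition next (x : node) : node :=
  odflt x [pick y | if goes_right x then row_edge M x y && row_inflow y
                    else column_edge M x y && column_inflow y].

Lemma first_vertex_right (i : 'I_k) c : c <= n -> h i c ->
  exists l : 'I_n, [/\ c <= l, is_vertex M i l, h i l
    & forall m : 'I_n, c <= m < l -> ~~ is_vertex M i m].
Proof.
have [h_end _ fl] := hv_flow; move: c; apply: downward_ind.
  by rewrite (negbTE (proj2 (h_end i))).
move=> c ltcn IHc hc; case: (boolP (is_vertex M i (Ordinal ltcn))) => [Vc|nVc].
  by exists (Ordinal ltcn); split=> // m; rewrite /= leqNgt; case: (_ < _).
have := fl i (Ordinal ltcn); rewrite flow_straight //= hc => /andP[/eqP/esym h1 _].
have [l [ltl Vl hl nV]] := IHc h1; exists l; split=> //; first exact: ltnW.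
move=> m /andP[]; rewrite leq_eqVlt => /predU1P[eqc|ltm] lem.
  by rewrite (_ : m = Ordinal ltcn) //; apply: val_inj.
by apply: nV; rewrite ltm.
Qed.

Lemma first_vertex_up r (j : 'I_n) : r <= k -> v r j ->
  (exists i : 'I_k, [/\ i < r, is_vertex M i j, v i.+1 j
     & forall m : 'I_k, i < m < r -> ~~ is_vertex M m j]) \/
  (v 0 j /\ forall m : 'I_k, m < r -> ~~ is_vertex M m j).
Proof.
have [_ _ fl] := hv_flow; elim: r => [|r IHr] ltrk vr; first by right.
case: (boolP (is_vertex M (Ordinal ltrk) j)) => [Vr|nVr].
  left; exists (Ordinal ltrk); split=> // m /=; rewrite ltnS ltnNge; by case: (_ <= _).
have := fl (Ordinal ltrk) j; rewrite flow_straight //= vr => /andP[_ /eqP/esym v1].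
have nV (m : 'I_k) : m < r.+1 -> (m < r -> ~~ is_vertex M m j) -> ~~ is_vertex M m j.
  rewrite ltnS leq_eqVlt => /predU1P[eqm _|ltm]; last exact.
  by rewrite (_ : m = Ordinal ltrk) //; apply: val_inj.
have [[i [lti Vi vi nVi]]|[v0 nV0]] := IHr (ltnW ltrk) v1; [left|right].
  exists i; split=> //; first exact: ltnW.
  by move=> m /andP[ltim ltm]; apply: nV ltm _ => ltm; apply: nVi; rewrite ltim.
by split=> // m ltm; apply: nV ltm _ => ltm; apply: nV0.
Qed.

Lemma inflow_elbow (i : 'I_k) (j : 'I_n) : is_vertex M i j ->
  h i j || v i.+1 j -> M i j = Elbow.
Proof.
have [_ _ /(_ i j)] := hv_flow; rewrite /is_vertex; case: (M i j) => //=.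
by case/and3P=> /negbTE-> /negbTE->.
Qed.

Lemma inflow_occupied (i : 'I_k) (j : 'I_n) : is_vertex M i j ->
  h i j || v i.+1 j -> occupied (inl (i, j)).
Proof.
move=> Vij hv; have Mij := inflow_elbow Vij hv.
have [_ _ /(_ i j)] := hv_flow; rewrite /= Vij Mij /= hv.
by case/and3P=> _ _ /eqP <-.
Qed.

Lemma next_spec x : occupied (inl x) ->
  if goes_right (inl x) then row_edge M (inl x) (next (inl x)) && row_inflow (next (inl x))
  else column_edge M (inl x) (next (inl x)) && column_inflow (next (inl x)).
Proof.
case: x => i j; rewrite /next; case: pickP => [//|none] /= /andP[Vij hv].
move: none => /=; case: (boolP (h i j.+1)) hv => [hij _|nh /= vij] none.
  have [l [lel Vl hl nV]] := first_vertex_right (ltn_ord j) hij.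
  have := none (inl (i, l)); rewrite /= hl andbT Vij Vl eqxx lel.
  rewrite (inflow_elbow Vl) ?hl //= => /forallP[] m.
  by apply/implyP => /nV.
have [[l [ltl Vl vl nV]]|[v0 nV]] := first_vertex_up (ltnW (ltn_ord i)) vij.
  have := none (inl (l, j)); rewrite /= vl andbT Vij Vl eqxx ltl => /forallP[] m.
  by apply/implyP => /nV.
have := none (inr j); rewrite /= v0 andbT Vij eqxx => /forallP[] m.
by apply/implyP => /nV.
Qed.

Lemma next_edge x : occupied (inl x) -> edge M (inl x) (next (inl x)).
Proof.
by move/next_spec; rewrite /edge; case: ifP => _ /andP[-> _]; rewrite ?orbT.
Qed.

Lemma next_occupied x : occupied (inl x) -> occupied (next (inl x)).
Proof.
move/next_spec; case: (next _) => [[i j]|j]; last by case: ifP => _ /andP[].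
case: ifP => _ /andP[e hv]; apply: inflow_occupied.
- by case: x e => i' j' /and5P[].
- by rewrite [h i j]hv.
- by case: x e => i' j' /and5P[].
- by rewrite [v i.+1 j]hv orbT.
Qed.

Lemma next_not_source x : occupied (inl x) -> ~~ is_source M (next (inl x)).
Proof.
move/next_spec; case: (next _) => [[i j]|j] //.
case: ifP => _ /andP[e hv].
  by case: x e => i' j' /and5P[].
by case: x e => i' j' /and5P[_ Vij _ _ _]; rewrite /= (inflow_elbow Vij) // [v i.+1 j]hv orbT.
Qed.

Lemma row_edge_inj x x' y : row_edge M x y -> row_edge M x' y -> x = x'.
Proof.
case: x x' y => [[i l]|//] [[i' l']|//] [[r c]|//].
case/and5P=> Vx _ _ /eqP eqi /andP[lt nV] /and5P[Vx' _ _ /eqP eqi' /andP[lt' nV']].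
subst i i'; congr (inl (_, _)); apply/val_inj/anti_leq; apply/andP; split; rewrite leqNgt.
  by apply: contraL Vx => lt2; move/forallP/(_ l): nV'; rewrite lt2 lt.
by apply: contraL Vx' => lt2; move/forallP/(_ l'): nV; rewrite lt2 lt'.
Qed.

Lemma column_edge_inj x x' y : column_edge M x y -> column_edge M x' y -> x = x'.
Proof.
case: x x' y => [[i l]|//] [[i' l']|//] [[r c]|c].
  case/and5P=> Vx _ /eqP eqc lt nV /and5P[Vx' _ /eqP eqc' lt' nV'].
  subst l l'; congr (inl (_, _)); apply/val_inj/anti_leq; apply/andP; split; rewrite leqNgt.
    by apply: contraL Vx' => lt2; move/forallP/(_ i'): nV; rewrite lt2 lt'.
  by apply: contraL Vx => lt2; move/forallP/(_ i): nV'; rewrite lt2 lt.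
case/and3P=> Vx /eqP eqc nV /and3P[Vx' /eqP eqc' nV'].
subst l l'; congr (inl (_, _)); apply/val_inj/anti_leq; apply/andP; split; rewrite leqNgt.
  by apply: contraL Vx' => lt2; move/forallP/(_ i'): nV; rewrite lt2.
by apply: contraL Vx => lt2; move/forallP/(_ i): nV'; rewrite lt2.
Qed.

(** The origin of a row edge, or of a column edge, is determined by its end; and one of each kind
    cannot both carry flow into the same elbow. *)
Lemma next_inj x x' : occupied (inl x) -> occupied (inl x') ->
  next (inl x) = next (inl x') -> x = x'.
Proof.
have mixed z z' y : row_edge M z y -> row_inflow y -> column_edge M z' y ->
    column_inflow y -> False.
  case: y => [[i j]|j]; last by case: z => [[]|].
  case: z => [[i' j']|//] /and5P[_ Vij nS _ _] /= hij _ vij.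
  have [_ _ /(_ i j)] := hv_flow; rewrite (inflow_elbow Vij) ?hij //=.
  by rewrite vij.
move=> /next_spec + /next_spec + eqn; rewrite -eqn.
case: ifP => _ /andP[e f]; case: ifP => _ /andP[e' f'].
- by have [] := row_edge_inj e e'.
- by have := mixed _ _ _ e f e' f'.
- by have := mixed _ _ _ e' f' e f.
- by have [] := column_edge_inj e e'.
Qed.

Fixpoint walk m (x : node) : seq node :=
  if m is m'.+1 then
    if x is inl _ then next x :: walk m' (next x) else [::]
  else [::].

Definition follows (x y : node) : bool :=
  [&& occupied x, if x is inl _ then true else false & y == next x].

Lemma walk_follows m x : occupied x -> path follows x (walk m x).
Proof.
elim: m x => //= m IHm [x|//] ox /=.
by rewrite /follows ox eqxx IHm // next_occupied.
Qed.

Lemma follows_edge x y : follows x y -> edge M x y.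
Proof. by case: x => [x|x] /and3P[ox // _ /eqP->]; apply: next_edge. Qed.

(** Each step raises the rank, and boxes have rank below [n + k], so the fuel [m] suffices to reach
    a sink. *)
Lemma walk_last m x : occupied x -> n + k < m + rank x ->
  exists2 j : 'I_n, last x (walk m x) = inr j & v 0 j.
Proof.
elim: m x => [|m IHm] [x|j] ox lem /=.
- by case: x ox lem => i j /= _; have := ltn_ord j; lia.
- by exists j.
- apply: IHm; first exact: next_occupied.
  by have := edge_rank (next_edge ox); lia.
- by exists j.
Qed.

Definition flow_path (a : 'I_k) : node * seq node :=
  (inl (a, pc a), walk (n + k).+1 (inl (a, pc a))).

Lemma source_occupied a : occupied (inl (a, pc a)).
Proof.
have Ma : M a (pc a) = Pivot by apply/eqP; rewrite pivotM.
have [_ _ /(_ a (pc a))] := hv_flow; rewrite /= /is_vertex Ma /=.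
by case/and3P=> _ _; case: (h _ _) (v _ _) => [] [].
Qed.

Lemma flow_path_last a :
  exists2 j : 'I_n, last (flow_path a).1 (flow_path a).2 = inr j & v 0 j.
Proof. by apply: walk_last; [exact: source_occupied | lia]. Qed.

(** A common node is traced back, by [next_inj] and induction on the rank, to a common source;
    sources have no predecessor. *)
Lemma flow_path_unique a b x : x \in (flow_path a).1 :: (flow_path a).2 ->
  x \in (flow_path b).1 :: (flow_path b).2 -> a = b.
Proof.
have tail d y : y \in (flow_path d).2 -> exists x0,
    [/\ inl x0 \in (flow_path d).1 :: (flow_path d).2, occupied (inl x0)
      & y = next (inl x0)].
  move=> /(step_to (flow_path d).1) [[x0|x0] xy].
    have := path_step (walk_follows _ (source_occupied d)) xy.
    by case/and3P=> ox _ /eqP yE; exists x0; split=> //; case/mem_step: xy.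
  by have := path_step (walk_follows _ (source_occupied d)) xy; case/and3P.
have [m] := ubnP (rank x); elim: m x => // m IHm x ltx.
rewrite inE => /predU1P[xa|xa]; rewrite inE => /predU1P[xb|xb].
- by move: xb; rewrite xa => -[].
- have [x0 [_ ox0 xE]] := tail _ _ xb.
  by have := next_not_source ox0; rewrite -xE xa /= pivotM eqxx.
- have [x0 [_ ox0 xE]] := tail _ _ xa.
  by have := next_not_source ox0; rewrite -xE xb /= pivotM eqxx.
have [x0 [x0a ox0 xE]] := tail _ _ xa; have [x1 [x1b ox1 xE1]] := tail _ _ xb.
have eqx : x0 = x1 by apply: next_inj => //; rewrite -xE.
apply: (IHm (inl x0)) => //; last by rewrite eqx.
by have := edge_rank (next_edge ox0); rewrite -xE => /leq_trans; apply.
Qed.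

Lemma flow_path_admissible : admissible_collection M flow_path.
Proof.
split=> [a|a b /eqP neqab [x [xa xb]]]; last exact/neqab/(flow_path_unique xa xb).
split; first by rewrite /= pivotM.
  apply: sub_path (walk_follows _ (source_occupied a)); exact: follows_edge.
by have [j lj _] := flow_path_last a; exists j.
Qed.

(** Sum the local rules over the row: the horizontal edges cancel, as both ends are unoccupied, and
    the pivot creates one path. *)
Lemma row_count (r : 'I_k) : \sum_(c < n) v r c = (\sum_(c < n) v r.+1 c).+1.
Proof.
have [h_end _ fl] := hv_flow.
have E : \sum_(c < n) (h r c + v r.+1 c + (c == pc r)) = \sum_(c < n) (h r c.+1 + v r c).
  apply: eq_bigr => c _; have := fl r c; rewrite -pivotM.
  by case: (M r c); case: (h r c) (v r.+1 c) (h r c.+1) (v r c) => [] [] [] [].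
have hE : \sum_(c < n) h r c = \sum_(c < n) h r c.+1.
  have [/negbTE h0 /negbTE hn] := h_end r.
  have := erefl (\sum_(0 <= c < n.+1) (h r c : nat)).
  by rewrite {1}big_nat_recr // big_nat_recl //= h0 hn addn0 add0n !big_mkord.
have pE : \sum_(c < n) (c == pc r) = 1.
  by rewrite (bigD1 (pc r)) //= eqxx big1 // => c /negbTE->.
by move: E; rewrite !big_split /= hE pE -addnA => /addnI<-; rewrite addn1.
Qed.

Lemma flow_card : #|[set j : 'I_n | v 0 j]| = k.
Proof.
have [_ v_end _] := hv_flow.
rewrite -sum1_card big_mkcond /=; under eq_bigr => j _ do rewrite inE.
have cnt : forall r, r <= k -> \sum_(c < n) v r c = k - r.
  apply: downward_ind => [|r ltrk IHr].
    by rewrite subnn big1 // => c _; rewrite (negbTE (v_end c)).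
  by rewrite (row_count (Ordinal ltrk)) IHr; lia.
rewrite -[RHS]subn0 -(cnt 0) //; apply: eq_bigr => j _; by case: (v 0 j).
Qed.

(** Every endpoint is an occupied sink, and there are [k] distinct endpoints and, by [flow_card],
    [k] occupied sinks. *)
Lemma flow_path_sinks : sink_set flow_path = [set j : 'I_n | v 0 j].
Proof.
apply/eqP; rewrite eqEcard flow_card; apply/andP; split.
  apply/subsetP => j; rewrite !inE => /existsP[a /eqP].
  by have [j' -> v0] := flow_path_last a => -[<-].
pose f a := if last (flow_path a).1 (flow_path a).2 is inr j then j else pc a.
have fE a : last (flow_path a).1 (flow_path a).2 = inr (f a).
  by rewrite /f; have [j ->] := flow_path_last a.
rewrite -[leqLHS]card_ord -(card_imset _ (_ : injective f)).
  apply/subset_leq_card/subsetP => _ /imsetP[a _ ->].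
  by rewrite inE; apply/existsP; exists a; rewrite fE.
move=> a b eqf; apply: (@flow_path_unique a b (inr (f a))); first by rewrite -fE mem_last.
by rewrite eqf -fE mem_last.
Qed.

End FlowToPaths.

Theorem bases_flow J : bases M J <->
  exists h v, flow_config M h v /\ J = [set j : 'I_n | v 0 j].
Proof.
split=> [[_ [P [admP ->]]]|[h [v [hv ->]]]].
  exists (used_h P), (used_v P); split; first exact: used_flow.
  by apply/setP => j; rewrite used_sink // inE.
split; first exact: flow_card hv.
exists (flow_path h v); split; first exact: flow_path_admissible.
by rewrite flow_path_sinks.
Qed.

End GraphFlow.

(** * Standardization *)

Lemma find_enum_ord n (a : pred 'I_n) :
  [/\ find a (enum 'I_n) <= n,
      forall j : 'I_n, j < find a (enum 'I_n) -> ~~ a j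
    & forall j : 'I_n, j = find a (enum 'I_n) :> nat -> a j].
Proof.
have szn : find a (enum 'I_n) <= n by rewrite -[leqRHS](size_enum_ord n) find_size.
split=> // j; first by move/(before_find j); rewrite nth_ord_enum => ->.
move=> jE; have : has a (enum 'I_n) by rewrite has_find size_enum_ord -jE.
by move/(nth_find j); rewrite -jE nth_ord_enum.
Qed.

(** Only the horizontal edges of the two rows and the vertical edges between them are rebuilt. The
    sinks are kept because [i'] is positive. *)
Lemma replace_two_rows k n (M M' : 'M[tile]_(k, n)) (i i' : 'I_k) h v :
  i' = i.+1 :> nat -> (forall r j, r != i -> r != i' -> M' r j = M r j) ->
  flow_config M h v ->
  (run2 n (v i'.+1) (v i) (tile_at M i) (tile_at M i') ->
   run2 n (v i'.+1) (v i) (tile_at M' i) (tile_at M' i')) ->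
  exists h' v', flow_config M' h' v' /\ forall j : 'I_n, v' 0 j = v 0 j.
Proof.
move=> hi eqM [h_end v_end fl] [].
  exists (fun c => (h i c, h i' c)); split.
  - have [/negbTE-> _] := h_end i; by have [/negbTE-> _] := h_end i'.
  - have [_ /negbTE->] := h_end i; by have [_ /negbTE->] := h_end i'.
  move=> c ltcn; have := fl i (Ordinal ltcn); have := fl i' (Ordinal ltcn).
  rewrite -!tile_atE /= hi => fl' fl0.
  by apply/hasP; exists (v i.+1 c); rewrite ?fl0 ?fl' //; case: (v _ _).
move=> s [s0 sn st].
(* The middle edge is occupied whenever the local rules allow it; otherwise [step2] guarantees that
   leaving it free works. *)
pose m c := flow (tile_at M' i c) (s c).1 true (s c.+1).1 (v i c) &&
            flow (tile_at M' i' c) (s c).2 (v i'.+1 c) (s c.+1).2 true.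
have mP c : c < n -> flow (tile_at M' i c) (s c).1 (m c) (s c.+1).1 (v i c) &&
            flow (tile_at M' i' c) (s c).2 (v i'.+1 c) (s c.+1).2 (m c).
  by move=> /st; rewrite /step2 /= orbF /m; case: (boolP (_ && _)) => [H _|].
exists (fun r c => if r == i :> nat then (s c).1 else if r == i' :> nat then (s c).2 else h r c).
exists (fun r c => if r == i' :> nat then m c else v r c); split; last first.
  by move=> j; rewrite hi.
have nii' : (nat_of_ord i' == i) = false by rewrite hi; apply/eqP; lia.
split=> [r|c|r c].
- rewrite s0 sn; case: ifP => // _; case: ifP => // _; exact: h_end.
- by rewrite gtn_eqF.
case: (eqVneq r i) => [->|neqi].
  rewrite eqxx -hi eqxx eq_sym nii' -tile_atE.
  by have /andP[] := mP c (ltn_ord c).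
rewrite -[_ == i :> nat]/(r == i) (negbTE neqi).
case: (eqVneq r i') => [->|neqi'].
  rewrite eqxx -tile_atE gtn_eqF //.
  by have /andP[] := mP c (ltn_ord c).
rewrite -[_ == i' :> nat]/(r == i') (negbTE neqi') eqM //.
have -> : (r.+1 == i' :> nat) = false by rewrite hi eqSS; apply/negbTE.
exact: fl.
Qed.

Section Standardize.

Variables (k n : nat) (D : 'M[tile]_(k, n)) (c : 'I_k -> 'I_n).
Variables (i i' : 'I_k).
Hypotheses (hi : i' = i.+1 :> nat) (hc : c i < c i').
Variables (le_kn : k <= n) (u w : 'S_n) (F : 'M[tile]_n).
Hypothesis fppF : flag_positroid_pipe_dream u w F.
Hypothesis DF : forall r j, D r j = F (widen_ord le_kn r) j.
Hypothesis cu : forall r, c r = u (widen_ord le_kn r).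

Let js := jstar c i i' D.
Let D' := standardize c i i' D.

Let rotheF := fpp_rothe fppF.

Lemma pivot_pfpp r (j : 'I_n) : (D r j == Pivot) = (j == c r).
Proof.
rewrite DF cu; case: (rotheP rotheF (widen_ord le_kn r) j) =>
  [->|h1 h2|h1 h2|h1 h2|h1 h2|h1 h2]; rewrite ?eqxx //;
  by symmetry; apply: contraTF h2 => /eqP->; rewrite ltnn.
Qed.

Lemma tile_at_pfpp r j : r < k -> j < n -> tile_at D r j = tile_at F r j.
Proof.
move=> ltr ltj; rewrite -[r]/(nat_of_ord (Ordinal ltr)) -[j]/(nat_of_ord (Ordinal ltj)).
by rewrite tile_atE DF -tile_atE.
Qed.

Lemma vertex_gt_pivot r (j : 'I_n) : is_vertex D r j -> c r <= j.
Proof.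
rewrite /is_vertex DF cu; case: (rotheP rotheF (widen_ord le_kn r) j) => [->|? ?|? ?|? ?|? ?|_ /ltnW] //=.
Qed.

(** Both sides say that the pivot of column [j] lies below the row; it is not in row [i'], whose
    pivot column is smaller than [j]. *)
Lemma cross_or_elbow_rows (j : 'I_n) : c i' < j ->
  (D i j = Cross \/ D i j = Elbow) <-> (D i' j = Cross \/ D i' j = Elbow).
Proof.
move=> ltj; have ltj0 := ltn_trans hc ltj.
have nj : (u^-1)%g j != i' :> nat.
  apply: contraTneq ltj => eqj; rewrite -leqNgt cu.
  by rewrite (_ : widen_ord le_kn i' = (u^-1)%g j) ?permKV //; apply/val_inj/esym.
rewrite !DF; move: ltj ltj0 nj; rewrite !cu.
case: (rotheP rotheF (widen_ord le_kn i) j) => /= [/(congr1 val)/= e|a1 a2|a1 a2|a1 a2|a1 a2|a1 a2];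
case: (rotheP rotheF (widen_ord le_kn i') j) => /= [/(congr1 val)/= e'|b1 b2|b1 b2|b1 b2|b1 b2|b1 b2];
  split=> -[]//; (lia || auto).
Qed.

Lemma pivot_column r : D r (c r) = Pivot.
Proof. by apply/eqP; rewrite pivot_pfpp. Qed.

Lemma standardize_top (j : 'I_n) : D' i j =
  if j == c i then Vertical
  else if (j <= c i') || (js <= j) then D i' j else D i j.
Proof.
have ne : (i == i') = false by rewrite -val_eqE /= hi; apply/eqP; lia.
by rewrite !mxE eqxx ne /= tpermL.
Qed.

Lemma standardize_bottom (j : 'I_n) : D' i' j =
  if j == c i' then Horizontal
  else if (c i' < js) && (j == js :> nat) then Elbow
  else if (j <= c i') || (js <= j) then D i j else D i' j.
Proof.
have ne : (i' == i) = false by rewrite -val_eqE /= hi; apply/eqP; lia.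
by rewrite !mxE eqxx ne /= tpermR.
Qed.

Lemma standardize_other r (j : 'I_n) : r != i -> r != i' -> D' r j = D r j.
Proof.
move=> nri nri'; rewrite !mxE (negbTE nri) (negbTE nri') /= tpermD 1?eq_sym //.
by case: ifP.
Qed.

Lemma jstarP : [/\ c i' <= js <= n,
  forall j : 'I_n, c i' <= j < js -> D i j = Cross -> ~~ is_vertex D i' j
  & forall j : 'I_n, j = js :> nat -> D i j = Cross /\ is_vertex D i' j].
Proof.
have [lejn before at_js] := find_enum_ord (fun j : 'I_n =>
  [&& c i' <= j, D i j == Cross & (D i' j == Elbow) || (D i' j == Pivot)]).
rewrite -/js in lejn before at_js; split.
- rewrite lejn andbT leqNgt; apply/negP => ltj.
  have /and3P[] := at_js (Ordinal (leq_trans ltj (ltnW (ltn_ord (c i'))))) (erefl _).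
  by rewrite /= leqNgt ltj.
- by move=> j /andP[lej /before]; rewrite lej /= /is_vertex orbC => + Dj; rewrite Dj eqxx.
by move=> j /at_js /and3P[_ /eqP-> Dj]; rewrite /is_vertex orbC.
Qed.

(** The flow is assumed only below row [i'], where D and D' agree, so that it may come from either
    of them; it serves to establish [no_crossing]. *)
Lemma rows_run2_equiv (h v : nat -> nat -> bool) :
  (forall r : 'I_k, i' < r -> ~~ h r n) -> (forall j : 'I_n, ~~ v k j) ->
  (forall (r : 'I_k) (j : 'I_n), i' < r ->
     flow (D r j) (h r j) (v r.+1 j) (h r j.+1) (v r j)) ->
  run2 n (v i'.+1) (v i) (tile_at D i) (tile_at D i') <->
  run2 n (v i'.+1) (v i) (tile_at D' i) (tile_at D' i').
Proof.
move=> h_end v_end fl; have [/andP[leqj lejn] before_js at_js] := jstarP.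
pose V r j := vert (tile_at F r j).
have ltin := leq_trans (ltn_ord i') le_kn.
have lekn r : r < k -> r < n by move/leq_trans; apply.
have meeting r j (x y : 'I_n) : r < k -> j < n ->
    left_label n V r j = Some x -> top_label n V r j = Some y -> x < y.
  move=> /lekn ltr ltj; exact: (meeting_order rotheF (fpp_reduced fppF)
    (fpp_no_touch fppF) (i := Ordinal ltr) (j := Ordinal ltj)).
have two_pipes r j : r < k -> j < n -> tile_at F r j = Cross \/ tile_at F r j = Elbow ->
    left_label n V r j /\ top_label n V r j.
  move=> /lekn ltr ltj; have := crossing_labels rotheF (i := Ordinal ltr) (j := Ordinal ltj).
  by rewrite -tile_atE.
have pivot_left r j : r < k -> j < n -> tile_at F r j = Pivot -> left_label n V r j = None.
  move=> /lekn ltr ltj; have := rothe_left_existsE rotheF (Ordinal ltr) (ltnW ltj).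
  rewrite -[r]/(nat_of_ord (Ordinal ltr)) -[j]/(nat_of_ord (Ordinal ltj)) tile_atE.
  case: (rotheP rotheF (Ordinal ltr) (Ordinal ltj)) => //= <-; rewrite ltnn.
  by case: left_label.
have A_ j (ltj : j < n) : tile_at D i j = D i (Ordinal ltj) by rewrite -tile_atE.
have B_ j (ltj : j < n) : tile_at D i' j = D i' (Ordinal ltj) by rewrite -tile_atE.
have A'_ j (ltj : j < n) : tile_at D' i j = D' i (Ordinal ltj) by rewrite -tile_atE.
have B'_ j (ltj : j < n) : tile_at D' i' j = D' i' (Ordinal ltj) by rewrite -tile_atE.
have ne_col j (ltj : j < n) r : j != c r :> nat -> (Ordinal ltj == c r) = false.
  by move=> nj; rewrite -val_eqE; apply/negbTE.
have A_gt j : c i' < j < n -> tile_at D i j <> Pivot.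
  move=> /andP[lt1 ltj]; rewrite (A_ _ ltj) => /eqP.
  by rewrite pivot_pfpp ne_col //; apply/eqP; lia.
have B_lt j : j < c i' -> ~~ vert (tile_at D i' j).
  move=> lt1; have ltj := ltn_trans lt1 (ltn_ord _); rewrite (B_ _ ltj).
  by apply: contraTN lt1 => /vertex_gt_pivot /=; rewrite leqNgt.
have B_q : tile_at D i' (c i') = Pivot by rewrite tile_atE pivot_column.
have B_gt j : c i' < j < n -> tile_at D i' j <> Pivot.
  move=> /andP[lt1 ltj]; rewrite (B_ _ ltj) => /eqP.
  by rewrite pivot_pfpp ne_col //; apply/eqP; lia.
(* A cross above the pivot of row [i'] would make j* equal to [c i']. *)
have A_q : c i' < js -> tile_at D i (c i') = Elbow.
  move=> ltj; rewrite tile_atE; have := before_js (c i'); rewrite leqnn ltj => /(_ isT).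
  rewrite /is_vertex pivot_column orTb; move: (pivot_pfpp i (c i')).
  rewrite -(inj_eq val_inj) /= (gtn_eqF hc) DF cu.
  case: (rotheP rotheF (widen_ord le_kn i) (u (widen_ord le_kn i'))) => //=;
    rewrite ?permK /= -?cu; try lia.
  by move=> _ _ _ /(_ erefl).
(* Above an elbow of row [i'] there is a cross or an elbow, and a cross would have stopped the
   search for j*. *)
have AB_mid j : c i' < j < js -> vert (tile_at D i' j) -> vert (tile_at D i j).
  move=> /andP[lt1 ltj]; have ltn := leq_trans ltj lejn.
  move=> Vb; have := vert_elbow Vb (@B_gt j _); rewrite lt1 ltn => /(_ isT).
  move: Vb; rewrite (A_ _ ltn) (B_ _ ltn) => Vb Eb.
  have [Ac|->//] := proj2 (@cross_or_elbow_rows (Ordinal ltn) lt1) (or_intror Eb).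
  by have := before_js (Ordinal ltn); rewrite /= ltj (ltnW lt1) Ac /is_vertex Eb => /(_ isT erefl).
have ltiK : i.+1 < k by rewrite -hi.
(* In column j* a cross lies above a vertex, so [vertex_below_cross] clears the rest of the upper
   row. *)
have A_ge j : js <= j < n -> ~~ vert (tile_at D i j).
  move=> /andP[lej ltj]; have ltjs := leq_ltn_trans lej ltj.
  have [Cjs Vjs] := at_js (Ordinal ltjs) erefl.
  move: lej; rewrite leq_eqVlt => /predU1P[<-|ltjj]; first by rewrite (A_ _ ltjs) Cjs.
  rewrite tile_at_pfpp //.
  apply: (vertex_below_cross meeting two_pipes pivot_left ltiK (j := js)); first by rewrite ltjj.
    by rewrite -tile_at_pfpp // (A_ _ ltjs).
  by rewrite -hi -tile_at_pfpp // (B_ _ ltjs).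
have B_js : c i' < js < n -> tile_at D i' js = Elbow.
  move=> ltj; have /andP[_ ltjs] := ltj; have [_ Vjs] := at_js (Ordinal ltjs) erefl.
  apply: vert_elbow (B_gt _ ltj); by rewrite (B_ _ ltjs).
have no_crossing j : c i' < j < js -> vert (tile_at D i j) -> ~~ vert (tile_at D i' j) ->
    v i'.+1 j -> ~ free_next n (tile_at D i') (v i'.+1) j.+1.
  move=> /andP[lt1 ltj] Va nVb vj; have ltn := leq_trans ltj lejn.
  have Ea : tile_at D i j = Elbow.
    by apply: vert_elbow Va (@A_gt _ _); rewrite lt1.
  have Cb : tile_at D i' j = Cross.
    move: nVb Ea; rewrite (A_ _ ltn) (B_ _ ltn) => nVb Ea.
    have [//|Eb] := proj1 (@cross_or_elbow_rows (Ordinal ltn) lt1) (or_intror Ea).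
    by rewrite Eb in nVb.
  move=> [j2 [/andP[ltj2 lt2n] V2 nv2 nV2]].
  have tE l : l < n -> tile_at D i' l = tile_at F i' l by apply: tile_at_pfpp.
  apply: (@cross_not_crossed n k (tile_at F) meeting two_pipes pivot_left i'.+1 h v _ _ _
    i' j) => //.
  - by move=> r /andP[ltr ltrk]; apply: (h_end (Ordinal ltrk)).
  - by move=> l ltl; apply: (v_end (Ordinal ltl)).
  - move=> r l /andP[ltr ltrk] ltl; rewrite -tile_at_pfpp //.
    by have := fl (Ordinal ltrk) (Ordinal ltl) ltr; rewrite -tile_atE.
  - by rewrite -tE.
  exists j2; split=> //; [by rewrite ltj2 | by rewrite -tE |].
  by move=> l /andP[l1 l2]; rewrite -tE ?nV2 ?l1 //; apply: ltn_trans lt2n.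
have A'_lt j : j < c i' -> ~~ vert (tile_at D' i j).
  move=> ltj; have ltn := ltn_trans ltj (ltn_ord _).
  rewrite (A'_ _ ltn) standardize_top /= (ltnW ltj); case: ifP => // _.
  by rewrite -(B_ _ ltn) B_lt.
have B'_lt j : j < c i' -> tile_at D' i' j = tile_at D i j.
  move=> ltj; have ltn := ltn_trans ltj (ltn_ord _).
  rewrite (B'_ _ ltn) (A_ _ ltn) standardize_bottom /= (ltnW ltj) ne_col; last by apply/eqP; lia.
  by rewrite ltn_eqF ?andbF // (leq_trans ltj).
have A'_q : tile_at D' i (c i') = Pivot.
  by rewrite tile_atE standardize_top -val_eqE /= gtn_eqF // leqnn pivot_column.
have B'_q : ~~ vert (tile_at D' i' (c i')).
  by rewrite tile_atE standardize_bottom eqxx.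
have A'_mid j : c i' < j < js -> tile_at D' i j = tile_at D i j.
  move=> /andP[lt1 ltj]; have ltn := leq_trans ltj lejn.
  rewrite (A'_ _ ltn) (A_ _ ltn) standardize_top /= ne_col; last by apply/eqP; lia.
  by have -> : ((j <= c i') || (js <= j)) = false by lia.
have B'_mid j : c i' < j < js -> tile_at D' i' j = tile_at D i' j.
  move=> /andP[lt1 ltj]; have ltn := leq_trans ltj lejn.
  rewrite (B'_ _ ltn) (B_ _ ltn) standardize_bottom /= ne_col; last by apply/eqP; lia.
  have -> : ((j <= c i') || (js <= j)) = false by lia.
  by rewrite (ltn_eqF ltj) andbF.
have A'_js : c i' < js < n -> tile_at D' i js = Elbow.
  move=> ltj; have /andP[lt1 ltn] := ltj; rewrite (A'_ _ ltn) standardize_top /= ne_col.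
    by rewrite leqnn orbT -(B_ _ ltn) B_js.
  by apply/eqP; lia.
have B'_js : c i' < js < n -> tile_at D' i' js = Elbow.
  move=> /andP[lt1 ltn]; rewrite (B'_ _ ltn) standardize_bottom /= ne_col.
    by rewrite lt1 eqxx.
  by apply/eqP; lia.
have A'_gt j : js < j < n -> tile_at D' i j = tile_at D i' j.
  move=> /andP[lt1 ltn]; rewrite (A'_ _ ltn) (B_ _ ltn) standardize_top /= ne_col.
    by rewrite (ltnW lt1) orbT.
  by apply/eqP; lia.
have B'_gt j : js < j < n -> ~~ vert (tile_at D' i' j).
  move=> /andP[lt1 ltn]; rewrite (B'_ _ ltn) standardize_bottom /= ne_col.
    rewrite (ltnW lt1) orbT gtn_eqF // andbF -(A_ _ ltn).
    by apply: A_ge; rewrite ltnW.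
  by apply/eqP; lia.
split.
- by apply: (run2_forward (q := c i') (js := js)).
- by apply: (run2_backward (q := c i') (js := js)).
Qed.

Definition standard_pivot r : 'I_n :=
  if r == i then c i' else if r == i' then c i else c r.

(** This is the property of D' that [bases_flow] asks for. *)
Lemma pivot_standardize r (j : 'I_n) : (D' r j == Pivot) = (j == standard_pivot r).
Proof.
have [/andP[leqj _] _ _] := jstarP; rewrite /standard_pivot.
case: (eqVneq r i) => [->|nri].
  rewrite standardize_top; case: (eqVneq j (c i)) => [->|nj].
    by rewrite -val_eqE ltn_eqF.
  case: ifPn => [_|]; first exact: pivot_pfpp.
  rewrite pivot_pfpp (negbTE nj) negb_or -ltnNge => /andP[lt _].
  by rewrite -val_eqE gtn_eqF.
case: (eqVneq r i') => [->|nri']; last by rewrite standardize_other // pivot_pfpp.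
rewrite standardize_bottom; case: (eqVneq j (c i')) => [->|nj].
  by rewrite -val_eqE gtn_eqF.
case: ifPn => [/andP[lt /eqP ej]|_].
  by rewrite -val_eqE /= ej gtn_eqF // (leq_trans hc (ltnW lt)).
case: ifPn => [_|]; first exact: pivot_pfpp.
rewrite pivot_pfpp (negbTE nj) negb_or -ltnNge => /andP[lt _].
by rewrite -val_eqE gtn_eqF // (ltn_trans hc).
Qed.

Lemma standardize_bases : bases D = bases D'.
Proof.
have transfer (M M' : 'M[tile]_(k, n)) h v : (forall r j, r != i -> r != i' -> M' r j = M r j) ->
    flow_config M h v ->
    (run2 n (v i'.+1) (v i) (tile_at M i) (tile_at M i') ->
     run2 n (v i'.+1) (v i) (tile_at M' i) (tile_at M' i')) ->
    exists h' v', flow_config M' h' v' /\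
      [set j : 'I_n | v 0 j] = [set j : 'I_n | v' 0 j].
  move=> eqM hv run; have [h' [v' [hv' vE]]] := replace_two_rows hi eqM hv run.
  by exists h', v'; split=> //; apply/setP => j; rewrite !inE vE.
have below (r : 'I_k) : i' < r -> r != i /\ r != i'.
  by move=> ltr; split; apply: contraTneq ltr => ->; rewrite -leqNgt // hi.
apply/classical_sets.seteqP; split=> J.
  move=> /(bases_flow pivot_pfpp)[h [v [hv ->]]]; apply/(bases_flow pivot_standardize).
  have [h_end v_end fl] := hv.
  apply: transfer hv _; first exact: standardize_other.
  apply: (proj1 (@rows_run2_equiv h v _ _ _)) => //.
  by move=> r _; case: (h_end r).
move=> /(bases_flow pivot_standardize)[h [v [hv ->]]]; apply/(bases_flow pivot_pfpp).
have [h_end v_end fl] := hv.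
apply: transfer hv _; first by move=> r j ni ni'; rewrite standardize_other.
apply: (proj2 (@rows_run2_equiv h v _ _ _)) => //.
  by move=> r _; case: (h_end r).
by move=> r j /below[ni ni']; rewrite -(standardize_other j ni ni').
Qed.

End Standardize.

Theorem theorem4p34 (k n : nat) (D : 'M[tile]_(k, n)) (c : 'I_k -> 'I_n)
    (hD : partial_fpp c D) (i i' : 'I_k) (hi : i' = i.+1 :> nat)
    (hc : c i < c i') :
  bases D = bases (standardize c i i' D).
Proof.
have [le_kn [u [w [F [fppF DE cu]]]]] := hD.
by apply: (standardize_bases hi hc fppF _ cu) => r j; rewrite DE mxE.
Qed.
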